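(* Let $G$ be a compact connected abelian group with normalized Haar measure $\mu$, and let $\Gamma$ be a submonoid of the dual group $\widehat G$ (i.e. the trivial character $1\in\Gamma$ and $\Gamma$ is closed under the group operation). Assume (i) $\Gamma\ne\{1\}$ and (ii) $\Gamma$ is a Riesz set. Then the orthogonal projection $\Pi_\Gamma:L^2(G,\mu)\to H_\Gamma$ cannot be extended to a bounded linear operator on $L^1(G,\mu)$.
   Context: $\widehat G$ is the group of continuous homomorphisms $G\to\{|z|=1\}$. The Fourier transform of $f\in L^1(G,\mu)$ is $\mathcal{F}f(\xi)=\int_G f\,\overline{\xi}\,d\mu$, and of a regular complex Borel measure $\sigma$ is $\mathcal{F}\sigma(\xi)=\int_G\overline{\xi}\,d\sigma$. $H_\Gamma=\{f\in L^2(G,\mu):\mathcal{F}f(\xi)=0\ \forall\xi\notin\Gamma\}$. A set $\Gamma\subseteq\widehat G$ is a Riesz set if every regular complex Borel measure $\sigma$ on $G$ with $\mathcal{F}\sigma$ vanishing off $\Gamma$ is absolutely continuous with respect to $\mu$. *)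

(* Defs.v *)
From HB Require Import structures.
From mathcomp Require Import all_boot all_order all_algebra.
From mathcomp Require Import all_classical all_reals all_analysis.
From mathcomp Require Import complex.
Set Implicit Arguments. Unset Strict Implicit. Unset Printing Implicit Defensive.
Import Order.TTheory GRing.Theory Num.Theory.
Import numFieldNormedType.Exports.
Local Open Scope classical_set_scope.
Local Open Scope ring_scope.
Local Open Scope complex_scope.

Definition zpt (G : topologicalZmodType) : Type := G.
HB.instance Definition _ (G : topologicalZmodType) := Topological.on (zpt G).
HB.instance Definition _ (G : topologicalZmodType) := isPointed.Build (zpt G) 0.
Notation borel G := (g_sigma_algebraType (@open (zpt G))).

Section Defs.
Variables (R : realType) (G : topologicalZmodType).
Local Notation M := (borel G).
Local Notation C := R[i].

Definition regular_measure (m : set M -> \bar R) : Prop :=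
  forall A : set M, measurable A ->
    m A = ereal_inf [set m U | U in [set U : set G | open U /\ A `<=` U]] /\
    m A = ereal_sup [set m K | K in [set K : set G | compact K /\ K `<=` A]].

Definition normalized_haar (mu : {measure set M -> \bar R}) : Prop :=
  [/\ mu setT = 1%E, regular_measure mu &
      forall (x : G) (A : set M), measurable A ->
        mu [set x + y | y in A] = mu A].

Definition character (xi : G -> C) : Prop :=
  [/\ forall x y, xi (x + y) = xi x * xi y,
      forall x, Normc.normc (xi x) = 1 &
      continuous (fun x => complex.Re (xi x)) /\ continuous (fun x => complex.Im (xi x))].

Definition ctriv : G -> C := fun _ => 1.

Definition cmeasurable (f : M -> C) :=
  measurable_fun setT (fun x => complex.Re (f x)) /\
  measurable_fun setT (fun x => complex.Im (f x)).

Definition cintegral (mu : {measure set M -> \bar R}) (f : M -> C) : C :=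
  Rintegral mu setT (fun x => complex.Re (f x)) +i* Rintegral mu setT (fun x => complex.Im (f x)).

Definition L1 (mu : {measure set M -> \bar R}) (f : M -> C) :=
  cmeasurable f /\ mu.-integrable setT (fun x => (Normc.normc (f x))%:E).
Definition L2 (mu : {measure set M -> \bar R}) (f : M -> C) :=
  cmeasurable f /\ mu.-integrable setT (fun x => ((Normc.normc (f x)) ^+ 2)%:E).
Definition L1norm (mu : {measure set M -> \bar R}) (f : M -> C) : R :=
  Rintegral mu setT (fun x => Normc.normc (f x)).

Definition fourier (mu : {measure set M -> \bar R}) (f : M -> C) (xi : G -> C) : C :=
  cintegral mu (fun x => f x * conjc (xi x)).

Definition HGamma (mu : {measure set M -> \bar R}) (Gamma : set (G -> C)) (f : M -> C) :=
  L2 mu f /\ forall xi, character xi -> ~ Gamma xi -> fourier mu f xi = 0.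

Definition is_proj (mu : {measure set M -> \bar R}) (Gamma : set (G -> C)) (f g : M -> C) :=
  HGamma mu Gamma g /\
  forall h, HGamma mu Gamma h ->
    cintegral mu (fun x => (f x - g x) * conjc (h x)) = 0.

(* A regular complex Borel measure sigma is represented through its Jordan
   decomposition sigma = (m1 - m2) + i (m3 - m4), with m1..m4 finite regular
   positive Borel measures. *)
Definition sint (m m' : {measure set M -> \bar R}) (g : M -> R) : R :=
  Rintegral m setT g - Rintegral m' setT g.

Definition cmeasure_fourier (m1 m2 m3 m4 : {measure set M -> \bar R}) (xi : G -> C) : C :=
  let g := fun x => conjc (xi x) in
  (sint m1 m2 (fun x => complex.Re (g x)) - sint m3 m4 (fun x => complex.Im (g x))) +i*
  (sint m1 m2 (fun x => complex.Im (g x)) + sint m3 m4 (fun x => complex.Re (g x))).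

Definition cmeasure_abscont (mu m1 m2 m3 m4 : {measure set M -> \bar R}) :=
  forall A : set M, measurable A -> mu A = 0%E ->
    (m1 A - m2 A = 0)%E /\ (m3 A - m4 A = 0)%E.

Definition riesz_set (mu : {measure set M -> \bar R}) (Gamma : set (G -> C)) :=
  forall m1 m2 m3 m4 : {finite_measure set M -> \bar R},
    regular_measure m1 -> regular_measure m2 ->
    regular_measure m3 -> regular_measure m4 ->
    (forall xi, character xi -> ~ Gamma xi -> cmeasure_fourier m1 m2 m3 m4 xi = 0) ->
    cmeasure_abscont mu m1 m2 m3 m4.

Definition submonoid (Gamma : set (G -> C)) :=
  [/\ Gamma `<=` character, Gamma ctriv &
      forall xi eta, Gamma xi -> Gamma eta -> Gamma (fun x => xi x * eta x)].

Definition proj_extends_L1 (mu : {measure set M -> \bar R}) (Gamma : set (G -> C)) :=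
  exists (T : (M -> C) -> (M -> C)) (K : R),
    [/\ forall f, L1 mu f -> L1 mu (T f) /\ L1norm mu (T f) <= K * L1norm mu f,
        forall (a : C) f g, L1 mu f -> L1 mu g ->
          {ae mu, forall x, T (fun y => a * f y + g y) x = a * T f x + T g x} &
        forall f g, L2 mu f -> is_proj mu Gamma f g ->
          {ae mu, forall x, T f x = g x}].
End Defs.

(* Main.v *)
(* Pick a nontrivial character xi in Gamma; since G is connected, xi has infinite
   order.  Let F_N be the Fejer kernel |1 + xi + ... + xi^(N-1)|^2 / N, which has
   mean one.

   If xi^(-n) is in Gamma for some n > 0, put chi = xi^n, so that Gamma contains
   the group generated by chi.  A weak-* limit lambda of the measures F_N(chi) mu
   has Fourier transform vanishing off that group and is carried by ker chi, which
   is mu-null because F_N = N there: this contradicts the Riesz property.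

   Otherwise Gamma meets the group generated by xi exactly in the nonnegative
   powers, so the projection truncates F_N to them.  The L^1 norm of F_N is one,
   but pairing its truncation with the uniformly bounded function
   sum_(1 <= k <= N) (xi^k - xi^(-k)) / k gives H_N - 1, the harmonic sum, so the
   projection is not bounded in L^1 norm. *)
Require Import Defs.
From HB Require Import structures.
From mathcomp Require Import all_boot all_order all_algebra.
From mathcomp Require Import all_classical all_reals all_analysis.
From mathcomp Require Import measurable_realfun.
From mathcomp Require Import complex.
From mathcomp Require Import ring lra zify.
Import Order.TTheory GRing.Theory Num.Theory.
Import numFieldNormedType.Exports.
Local Open Scope classical_set_scope.
Local Open Scope ring_scope.
Set Implicit Arguments.
Unset Strict Implicit.
Unset Printing Implicit Defensive.

(** * Regularization of finitely additive probabilities *)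

(** The two cases need different tools. If [Gamma] is itself a group, the projection is an average
    over its annihilator, which is bounded on L^1; no norm estimate can then succeed and the
    contradiction has to come from the Riesz property. Passing from xi to xi^n is forced there,
    since [Gamma] may contain xi^(-n) without containing xi^(-1). G is not assumed metrizable, so
    the weak-* limit is taken along an ultrafilter instead of a subsequence. The functionals f |->
    integral of f F_N on bounded Borel functions then converge to a finitely additive probability,
    which is regularized starting from the open sets. Regularization keeps only an inequality on
    open sets; layer-cake sums carry it to continuous functions, and the symmetry f |-> -f makes it
    an equality. That the limit is carried by ker chi is read off a single coefficient: the integral
    of Re chi against F_N is 1 - 1/N, which tends to 1, the maximum of Re chi. The value H_N - 1
    arises because chi^k has coefficient 1 - k/N in F_N, and (1 - k/N)/k = 1/k - 1/N. *)

Lemma normal_space_open (X : topologicalType) (A U : set X) :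
  normal_space X -> closed A -> open U -> A `<=` U ->
  exists V, [/\ open V, A `<=` V & closure V `<=` U].
Proof.
move=> nX cA oU AU.
have [|W] := nX A cA U; first by apply/set_nbhsP; exists U; split.
move=> /set_nbhsP[V [oV AV VW]] WU.
by exists V; split => //; apply: subset_trans WU; exact: closureS.
Qed.

Section regularization.
Local Open Scope ereal_scope.
Variables (R : realType) (X : ptopologicalType).
Local Notation M := (g_sigma_algebraType (@open X)).
Hypotheses (hX : hausdorff_space X) (kX : compact [set: X]).
Variable L : set M -> R.
Hypothesis L0 : L set0 = 0%R.
Hypothesis LT : L setT = 1%R.
Hypothesis Lle : forall A B : set M, measurable A -> measurable B -> A `<=` B ->
  (L A <= L B)%R.
Hypothesis LU : forall A B : set M, measurable A -> measurable B ->
  A `&` B = set0 -> L (A `|` B) = (L A + L B)%R.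

Local Lemma open_measurableM (U : set X) : open U -> measurable (U : set M).
Proof. by move=> oU; exact: sub_sigma_algebra. Qed.

Local Lemma L_subU (A B : set M) : measurable A -> measurable B ->
  (L (A `|` B) <= L A + L B)%R.
Proof.
move=> mA mB.
have -> : A `|` B = A `|` (B `\` A) by rewrite setDE setUIr setUCr setIT.
rewrite LU//; last 2 first.
- exact: measurableD.
- by rewrite setDE setICA setICr setI0.
by rewrite lerD2l Lle//; exact: measurableD.
Qed.

(* Taking the supremum over V with closure V inside U (instead of L U itself)
   makes countable subadditivity follow from compactness. *)
Definition open_content (U : set X) : \bar R :=
  ereal_sup [set (L V)%:E | V in [set V : set X | open V /\ closure V `<=` U]].

Definition open_outer (A : set X) : \bar R :=
  ereal_inf [set open_content U | U in [set U : set X | open U /\ A `<=` U]].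

Local Notation m := open_content.
Local Notation ext := open_outer.

Lemma open_content_ub (U V : set X) : open V -> closure V `<=` U ->
  (L V)%:E <= m U.
Proof. by move=> oV VU; apply: ereal_sup_ubound; exists V. Qed.

Lemma le_open_content (U V : set X) : U `<=` V -> m U <= m V.
Proof.
move=> UV; apply: ereal_sup_le => _ [W [oW WU] <-]; exists W => //; split=> //.
exact: subset_trans UV.
Qed.

Lemma open_content_le (U : set X) : open U -> m U <= (L U)%:E.
Proof.
move=> oU; apply: ge_ereal_sup => _ [V [oV VU] <-]; rewrite lee_fin.
apply: Lle; [exact: open_measurableM|exact: open_measurableM|].
exact: subset_trans (@subset_closure _ V) VU.
Qed.

Lemma open_content_ge0 (U : set X) : 0 <= m U.
Proof.
rewrite -[leLHS]/(0%:E) -L0; apply: open_content_ub; first exact: open0.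
by rewrite closure0.
Qed.

Lemma open_content0 : m set0 = 0.
Proof.
apply/eqP; rewrite eq_le open_content_ge0 andbT.
by rewrite (le_trans (open_content_le open0))// L0.
Qed.

Lemma open_contentT : m setT = 1.
Proof.
apply/eqP; rewrite eq_le (le_trans (open_content_le openT)) ?LT//=.
by rewrite -[leLHS]/(1%:E) -LT; apply: open_content_ub; first exact: openT.
Qed.

(** Normality splits a test set [V]: [W1] absorbs the part of its closure outside [U2], [W2] absorbs
    what [W1] misses, and both have their closures in the right open set. Then [V] lies in the union
    of [W1] and [W2], where [L] is subadditive. *)
Lemma open_contentU (U1 U2 : set X) : open U1 -> open U2 ->
  m (U1 `|` U2) <= m U1 + m U2.
Proof.
move=> o1 o2; apply: ge_ereal_sup => _ [V [oV VU] <-].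
have nX := compact_normal hX kX.
have [||W1 [oW1 AW1 W1U]] := @normal_space_open _ (closure V `\` U2) U1 nX _ o1.
- by apply: closedI; [exact: closed_closure|exact: open_closedC].
- by move=> x [/VU[]].
have [||W2 [oW2 AW2 W2U]] := @normal_space_open _ (closure V `\` W1) U2 nX _ o2.
- by apply: closedI; [exact: closed_closure|exact: open_closedC].
- move=> x [Vx W1x]; apply: contrapT => U2x; apply: W1x; exact: AW1.
apply: (@le_trans _ _ ((L W1)%:E + (L W2)%:E)); last first.
  by apply: leeD; exact: open_content_ub.
rewrite -EFinD lee_fin (le_trans _ (L_subU _ _))//; last 2 first.
- exact: open_measurableM.
- exact: open_measurableM.
apply: Lle; [exact: open_measurableM|apply: open_measurableM; exact: openU|].
move=> x Vx; have cVx := subset_closure Vx.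
by have [|nW] := pselect (W1 x); [left|right; exact: AW2].
Qed.

Lemma open_content_bigcup (U : (set X)^nat) : (forall i, open (U i)) ->
  m (\bigcup_i U i) <= \sum_(i <oo) m (U i).
Proof.
move=> oU; apply: ge_ereal_sup => _ [V [oV VU] <-].
have : cover_compact (closure V).
  rewrite -compact_cover; apply: (subclosed_compact _ kX) => //.
  exact: closed_closure.
case/(_ nat setT U (fun i _ => oU i) VU) => D _ VD.
(* One more than the largest index of the finite subcover, so that it sits in an initial segment on
   which binary subadditivity can be iterated. *)
pose n := (\max_(i <- finmap.enum_fset D) i).+1.
have VUn : closure V `<=` \big[setU/set0]_(i < n) U i.
  move=> x /VD[i iD Ux]; rewrite -bigcup_mkord; exists i => //=.
  by rewrite ltnS; apply: (@leq_bigmax_seq _ _ xpredT id).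
have finsub k : open (\big[setU/set0]_(i < k) U i) /\
    m (\big[setU/set0]_(i < k) U i) <= \sum_(0 <= i < k) m (U i).
  elim: k => [|k [ok IH]].
    by rewrite big_ord0 big_nil open_content0; split=> //; exact: open0.
  rewrite big_ord_recr big_nat_recr//=; split; first exact: openU.
  by rewrite (le_trans (open_contentU _ _))// leeD2r.
rewrite (le_trans (open_content_ub oV VUn))// (le_trans (finsub n).2)//.
by apply: nneseries_lim_ge => i _ _; exact: open_content_ge0.
Qed.

Lemma open_content_superU (V W U : set X) : open V -> open W ->
  closure V `<=` U -> closure W `<=` U -> V `&` W = set0 ->
  (L V)%:E + (L W)%:E <= m U.
Proof.
move=> oV oW VU WU VW.
rewrite -EFinD -LU//; [|exact: open_measurableM|exact: open_measurableM].
by apply: open_content_ub; [exact: openU|rewrite closureU subUset].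
Qed.

Lemma open_outer_open (U : set X) : open U -> ext U = m U.
Proof.
move=> oU; apply/eqP; rewrite eq_le; apply/andP; split.
  by apply: ereal_inf_lbound; exists U => //; split.
by apply: le_ereal_inf_tmp => _ [V [oV UV] <-]; exact: le_open_content.
Qed.

(** * The outer measure and its Caratheodory sets *)

Lemma le_open_outer : {homo ext : A B / A `<=` B >-> A <= B}.
Proof.
move=> A B AB; apply: ereal_inf_le_tmp => _ [U [oU BU] <-]; exists U => //.
by split=> //; exact: subset_trans BU.
Qed.

Lemma open_outer_ge0 A : 0 <= ext A.
Proof.
by apply: le_ereal_inf_tmp => _ [U [oU AU] <-]; exact: open_content_ge0.
Qed.

Lemma open_outer0 : ext set0 = 0.
Proof. by rewrite open_outer_open ?open_content0//; exact: open0. Qed.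

Lemma open_outerT : ext setT = 1.
Proof. by rewrite open_outer_open ?open_contentT//; exact: openT. Qed.

Lemma open_outer_fin A : ext A \is a fin_num.
Proof.
rewrite ge0_fin_numE; last exact: open_outer_ge0.
by rewrite (le_lt_trans (le_open_outer (@subsetT _ A)))// open_outerT ltry.
Qed.

Lemma open_outer_sigma_subadditive : sigma_subadditive ext.
Proof.
move=> A; apply/lee_addgt0Pr => e e0.
rewrite (le_trans _ (@epsilon_trick R (ext \o A) e xpredT _ (ltW e0)))//; last first.
  by move=> n; exact: open_outer_ge0.
have /choice[U PU] n : exists U : set X, [/\ open U, A n `<=` U &
    m U <= ext (A n) + (e / (2 ^ n.+1)%:R)%:E].
  have en : (0 < e / (2 ^ n.+1)%:R)%R.
    by rewrite divr_gt0// ltr0n expn_gt0.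
  have [_ [U [oU AU] <-] Ux] := lb_ereal_inf_adherent en (open_outer_fin (A n)).
  by exists U; split => //; exact/ltW.
apply: (@le_trans _ _ (m (\bigcup_n U n))).
  apply: ereal_inf_lbound; exists (\bigcup_n U n) => //; split.
    by apply: bigcup_open => i _; have [] := PU i.
  by apply: subset_bigcup => i _; have [] := PU i.
rewrite (le_trans (open_content_bigcup _))//; first by move=> i; have [] := PU i.
apply: lee_nneseries => [n _ _|n _ /=]; last by have [] := PU n.
exact: open_content_ge0.
Qed.

HB.instance Definition _ := isOuterMeasure.Build R X ext
  open_outer0 open_outer_ge0 le_open_outer open_outer_sigma_subadditive.

(** Caratheodory sets form a sigma-algebra, so open [U] suffice. If [W] is an open cover of [Y] and
    [V] is a test set for the intersection of [W] and [U], then [W] minus the closure of [V] is open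
    and still covers the part of [Y] outside [U]. Its test sets are disjoint from [V], so
    [open_content_superU] adds the two contents inside [W]. *)
Lemma open_outer_caratheodory (A : set M) : measurable A ->
  caratheodory_measurable ext A.
Proof.
apply: (@smallest_sub _ _ (@open X) (caratheodory_measurable ext)); last first.
  move=> U oU; apply: le_caratheodory_measurable => Y.
  apply: le_ereal_inf_tmp => _ [W [oW YW] <-].
  apply: (@le_trans _ _ (m (W `&` U) + ext (W `&` ~` U))).
    apply: leeD.
      rewrite -open_outer_open; last exact: openI.
      by apply: le_open_outer; exact: setSI.
    by apply: le_open_outer; exact: setSI.
  rewrite -leeBrDr ?open_outer_fin//.
  apply: ge_ereal_sup => _ [V [oV VWU] <-].
  rewrite leeBrDr ?open_outer_fin// addeC -leeBrDr//.
  have oWV : open (W `&` ~` closure V).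
    by apply: openI => //; exact: closed_openC (@closed_closure _ V).
  rewrite (@le_trans _ _ (m (W `&` ~` closure V)))//.
    rewrite -open_outer_open//; apply: le_open_outer => x [Wx Ux]; split=> //.
    by move=> /VWU[].
  apply: ge_ereal_sup => _ [V' [oV' V'W] <-].
  rewrite leeBrDr// addeC; apply: open_content_superU => //.
  - by move=> x /VWU[].
  - by move=> x /V'W[].
  - apply/seteqP; split=> // x [Vx V'x].
    have [_] := V'W _ (subset_closure V'x); apply; exact: subset_closure.
split.
- exact: caratheodory_measurable_set0.
- move=> B mB; rewrite setTD; exact: caratheodory_measurable_setC.
- by move=> F mF; exact: caratheodory_measurable_bigcup.
Qed.

(** [L] is only finitely additive, so mass that it puts on an open set may escape to the boundary.
    Hence the last clause is an inequality and cannot be strengthened to an equality. *)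
Lemma exists_regularization : exists lam : {finite_measure set M -> \bar R},
  [/\ lam setT = 1,
      forall A : set M, measurable A ->
       lam A = ereal_inf [set lam U | U in [set U : set X | open U /\ A `<=` U]] /\
       lam A = ereal_sup [set lam K | K in [set K : set X | compact K /\ K `<=` A]]
    & forall U : set X, open U -> lam U <= (L U)%:E].
Proof.
have lam_sigma : semi_sigma_additive (ext : set M -> \bar R).
  move=> F mF tF mUF.
  exact: (@caratheodory_measure_sigma_additive R X ext F
    (fun i => open_outer_caratheodory (mF i)) tF (open_outer_caratheodory mUF)).
pose lm := isMeasure.Build _ M R ext open_outer0 open_outer_ge0 lam_sigma.
pose lam0 : {measure set M -> \bar R} :=
  HB.pack_for {measure set M -> \bar R} (ext : set M -> \bar R) lm.
have finlam : fin_num_fun lam0 by move=> A _; exact: open_outer_fin.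
pose lam : {finite_measure set M -> \bar R} :=
  HB.pack_for {finite_measure set M -> \bar R} (Measure.sort lam0)
   (Measure_isFinite.Build _ _ _ lam0 finlam).
exists lam.
have lamE A : lam A = ext A by [].
have outer A : ext A = ereal_inf [set lam U | U in [set U : set X | open U /\ A `<=` U]].
  rewrite /open_outer; congr ereal_inf; apply/seteqP; split=> _ [U [oU AU] <-].
    by exists U => //; rewrite lamE open_outer_open.
  by exists U => //; rewrite lamE open_outer_open.
have lamC A : measurable A -> lam (~` A) = 1 - lam A.
  move=> mA; rewrite -open_outerT -(setvU A) -!lamE measureU//; last by rewrite setICl.
    by rewrite addeK//; exact: open_outer_fin.
  exact: measurableC.
split.
- exact: open_outerT.
- move=> A mA; split; first by rewrite lamE; exact: outer.
  apply/eqP; rewrite eq_le; apply/andP; split; last first.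
    by apply: ge_ereal_sup => _ [K [cK KA] <-]; exact: le_open_outer.
  (* Inner regularity of [A] is outer regularity of its complement: the complement of an open set is
     closed, hence compact in [X]. *)
  have mCA : measurable (~` A) by exact: measurableC.
  apply/lee_addgt0Pr => e e0.
  have [_ [U [oU AU] <-] Ux] := lb_ereal_inf_adherent e0 (open_outer_fin (~` A)).
  have -> : lam A = 1 - lam (~` A).
    by rewrite -{1}(setCK A) lamC.
  apply: (@le_trans _ _ (lam (~` U) + e%:E)); last first.
    apply: leeD2r; apply: ereal_sup_ubound; exists (~` U) => //; split.
      by apply: (subclosed_compact _ kX) => //; exact: open_closedC.
    by move=> x Ux'; apply: contrapT => /AU.
  have mU : measurable (U : set M) by apply: open_measurableM.
  rewrite (lamC _ mU) (lamE U) open_outer_open//.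
  rewrite leeBlDr ?open_outer_fin//.
  have := ltW Ux; rewrite -/(ext (~` A)) -lamE.
  have := open_outer_fin (~` A); rewrite -lamE.
  have := open_outer_fin U; rewrite open_outer_open//.
  case: (m U) => [u| |]//; case: (lam (~` A)) => [a| |]// _ _.
  rewrite -!EFinD !lee_fin; lra.
- by move=> U oU; rewrite lamE open_outer_open//; exact: open_content_le.
Qed.

End regularization.

(** * States on bounded measurable functions *)

Section states.
Variables (R : realType) (d : measure_display) (T : measurableType d).
Implicit Types (I : (T -> R) -> R) (f g : T -> R).

Definition bounded_measurable f :=
  measurable_fun setT f /\ exists B, forall x, `|f x| <= B.

(** The functional form of a finitely additive probability. Countable additivity is left out because
    ultrafilter limits do not preserve it, whereas linearity, positivity and normalization pass to
    the limit. *)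
Definition state I :=
  [/\ forall a f g, bounded_measurable f -> bounded_measurable g ->
        I (fun x => a * f x + g x) = a * I f + I g,
      forall f, bounded_measurable f -> (forall x, 0 <= f x) -> 0 <= I f
    & I (fun=> 1) = 1].

Lemma bounded_measurable_cst c : bounded_measurable (fun=> c).
Proof. by split; [exact: measurable_cst|exists `|c|]. Qed.

Lemma bounded_measurable_lin a f g :
  bounded_measurable f -> bounded_measurable g ->
  bounded_measurable (fun x => a * f x + g x).
Proof.
move=> [mf [B fB]] [mg [C gC]]; split.
  by apply: measurable_funD => //; apply: measurable_funM.
exists (`|a| * B + C) => x; rewrite (le_trans (ler_normD _ _))//.
by rewrite normrM lerD// ler_wpM2l.
Qed.

Lemma bounded_measurableM f g :
  bounded_measurable f -> bounded_measurable g ->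
  bounded_measurable (fun x => f x * g x).
Proof.
move=> [mf [B fB]] [mg [C gC]]; split; first exact: measurable_funM.
by exists (B * C) => x; rewrite normrM ler_pM.
Qed.

Lemma bounded_measurable_sum n (F : nat -> T -> R) :
  (forall k, bounded_measurable (F k)) ->
  bounded_measurable (fun x => \sum_(k < n) F k x).
Proof.
move=> bF; elim: n => [|n IH].
  by under eq_fun do rewrite big_ord0; exact: bounded_measurable_cst.
have := bounded_measurable_lin 1 (bF n) IH.
by congr bounded_measurable; apply/funext => x; rewrite big_ord_recr/= mul1r addrC.
Qed.

Lemma bounded_measurable_indic (A : set T) : measurable A ->
  bounded_measurable (\1_A : T -> R).
Proof.
move=> mA; split; first exact: measurable_indic.
by exists 1 => x; rewrite indicE; case: (_ \in _); rewrite /= ?normr1 ?normr0.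
Qed.

Lemma state0 I : state I -> I (fun=> 0) = 0.
Proof.
move=> [Ilin _ _]; have b0 := bounded_measurable_cst 0.
transitivity (I (fun=> -1 * 0 + 0)).
  by congr I; apply/funext => x; rewrite mulr0 addr0.
by rewrite (Ilin (-1) _ _ b0 b0) (mulN1r (I _)) addNr.
Qed.

Lemma stateD I f g : state I -> bounded_measurable f -> bounded_measurable g ->
  I (fun x => f x + g x) = I f + I g.
Proof.
move=> [Ilin _ _] bf bg; rewrite -[I f]mul1r -Ilin//.
by congr I; apply/funext => x; rewrite mul1r.
Qed.

Lemma stateZ I a f : state I -> bounded_measurable f ->
  I (fun x => a * f x) = a * I f.
Proof.
move=> sI bf; have [Ilin _ _] := sI.
rewrite -[RHS]addr0 -(state0 sI) -Ilin//; last exact: bounded_measurable_cst.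
by congr I; apply/funext => x; rewrite addr0.
Qed.

Lemma state_sum I n (F : nat -> T -> R) : state I ->
  (forall k, bounded_measurable (F k)) ->
  I (fun x => \sum_(k < n) F k x) = \sum_(k < n) I (F k).
Proof.
move=> sI bF; elim: n => [|n IH].
  by rewrite big_ord0; under eq_fun do rewrite big_ord0; exact: state0.
rewrite big_ord_recr/= -IH -stateD//; last exact: bounded_measurable_sum.
by congr I; apply/funext => x; rewrite big_ord_recr.
Qed.

Lemma le_state I f g : state I -> bounded_measurable f -> bounded_measurable g ->
  (forall x, f x <= g x) -> I f <= I g.
Proof.
move=> [Ilin I0 _] bf bg fg; rewrite -subr_ge0 addrC -mulN1r -Ilin//.
apply: I0 => [|x]; first exact: bounded_measurable_lin.
by rewrite mulN1r addrC subr_ge0.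
Qed.

Lemma state_cst I c : state I -> I (fun=> c) = c.
Proof.
move=> sI; have [_ _ I1] := sI; rewrite -[RHS]mulr1 -[in RHS]I1 -stateZ//.
  by congr I; apply/funext => x; rewrite mulr1.
exact: bounded_measurable_cst.
Qed.

Lemma state_bound I f B : state I -> measurable_fun setT f ->
  (forall x, `|f x| <= B) -> `|I f| <= B.
Proof.
move=> sI mf fB; have bf : bounded_measurable f by split=> //; exists B.
have fBB x : - B <= f x <= B by rewrite -ler_norml.
rewrite ler_norml; apply/andP; split.
- rewrite -[leLHS](state_cst _ sI); apply: (le_state sI) => //.
    exact: bounded_measurable_cst.
  by move=> x; case/andP: (fBB x).
- rewrite -[leRHS](state_cst _ sI); apply: (le_state sI) => //.
    exact: bounded_measurable_cst.
  by move=> x; case/andP: (fBB x).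
Qed.

Lemma bounded_measurable_integrable (m : {measure set T -> \bar R}) f :
  (m setT < +oo)%E -> bounded_measurable f -> m.-integrable setT (EFin \o f).
Proof.
move=> moo [mf [B fB]]; apply: measurable_bounded_integrable => //.
exists B; split; first exact: num_real.
by move=> M BM x _ /=; rewrite (le_trans (fB x))// ltW.
Qed.

Lemma integrable_scale (m : {measure set T -> \bar R}) (a : R) (u : T -> R) :
  m.-integrable setT (EFin \o u) ->
  m.-integrable setT (EFin \o (fun x => a * u x)).
Proof. by move=> iu; have := integrableZl measurableT a iu. Qed.

Lemma integrable_add (m : {measure set T -> \bar R}) (u v : T -> R) :
  m.-integrable setT (EFin \o u) -> m.-integrable setT (EFin \o v) ->
  m.-integrable setT (EFin \o (fun x => u x + v x)).
Proof. by move=> iu iv; have := integrableD measurableT iu iv. Qed.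

Lemma Rintegral_lin (m : {measure set T -> \bar R}) (a b : R) (u v w : T -> R) :
  m.-integrable setT (EFin \o u) -> m.-integrable setT (EFin \o v) ->
  m.-integrable setT (EFin \o w) ->
  m.-integrable setT (EFin \o (fun x => a * u x + b * v x + w x)) /\
  Rintegral m setT (fun x => a * u x + b * v x + w x) =
  a * Rintegral m setT u + b * Rintegral m setT v + Rintegral m setT w.
Proof.
move=> iu iv iw.
have iau := integrable_scale a iu.
have ibv := integrable_scale b iv.
have iuv := integrable_add iau ibv.
split; first exact: integrable_add.
by rewrite RintegralD// RintegralD// !RintegralZl.
Qed.

Lemma state_density (m : {measure set T -> \bar R}) (w : T -> R) :
  (m setT < +oo)%E -> bounded_measurable w -> (forall x, 0 <= w x) ->
  Rintegral m setT w = 1 -> state (fun f => Rintegral m setT (fun x => f x * w x)).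
Proof.
move=> moo bw w0 w1; have int := bounded_measurable_integrable moo.
split.
- move=> a f g bf bg.
  have bfw := bounded_measurableM bf bw; have bgw := bounded_measurableM bg bw.
  rewrite -RintegralZl//; last exact: int.
  rewrite -RintegralD//; last 2 first.
    + apply: int; have := bounded_measurable_lin a bfw (bounded_measurable_cst 0).
      by congr bounded_measurable; apply/funext => x; rewrite addr0.
    + exact: int.
  by apply: eq_Rintegral => x _; rewrite mulrDl mulrA.
- by move=> f bf f0; apply: Rintegral_ge0 => x _; rewrite mulr_ge0.
- by rewrite -[RHS]w1; apply: eq_Rintegral => x _; rewrite mul1r.
Qed.

Lemma state_Rintegral (m : {measure set T -> \bar R}) :
  m setT = 1%E -> state (fun f => Rintegral m setT f).
Proof.
move=> m1; have moo : (m setT < +oo)%E by rewrite m1 ltry.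
have := @state_density m (fun=> 1) moo (bounded_measurable_cst 1) (fun=> ler01).
rewrite Rintegral_cst// m1 mulr1 => /(_ erefl).
congr state; apply/funext => f; apply: eq_Rintegral => x _; exact: mulr1.
Qed.

(** For each [f] the numbers [I_ n f] stay in the compact interval from [- B] to [B], where an
    ultrafilter converges. A single [U] serves all [f] at once, which a subsequence could not do
    without separability. *)
Lemma state_ultralimit (U : set_system nat) (I_ : nat -> (T -> R) -> R) :
  UltraFilter U -> (forall n, state (I_ n)) ->
  exists I, state I /\
    forall f, bounded_measurable f -> (fun n => I_ n f) @ U --> I f.
Proof.
move=> UU sI; have UF := ultra_proper.
have cvgI f : bounded_measurable f -> cvg ((fun n => I_ n f) @ U).
  move=> [mf [B fB]]; have := @segment_compact R (- B) B.
  rewrite compact_ultra => /(_ ((fun n => I_ n f) @ U)) [].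
  - split; first exact: fmap_proper_filter.
    (* The image of an ultrafilter is maximal: if the preimage of [A] is not in [U], its complement
       is, and [G] would contain two disjoint sets. *)
    move=> G PG UG; apply/seteqP; split=> // A GA.
    have [//|UA] := in_ultra_setVsetC ((fun n => I_ n f) @^-1` A) UU.
    have GnA : G (~` A) by apply: UG.
    have G0 : G set0 by rewrite -(setICr A); exact: filterI.
    by have := @filter_not_empty _ G PG G0.
  - apply: (@filterS _ U _ setT) => [n _ /=|]; last exact: filterT.
    by rewrite in_itv/= -ler_norml; exact: (state_bound (sI n) mf).
  - by move=> l [_ Il]; apply/cvg_ex; exists l.
exists (fun f => lim ((fun n => I_ n f) @ U)); split; last first.
  by move=> f /cvgI.
split.
- move=> a f g bf bg; apply/cvg_lim => //.
  have -> : (fun n => I_ n (fun x => a * f x + g x)) =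
     (fun n => a * I_ n f + I_ n g).
    by apply/funext => n; have [-> //] := sI n.
  apply: cvgD; last exact: cvgI.
  by apply: cvgM; [exact: cvg_cst|exact: cvgI].
- move=> f bf f0; apply: limr_ge; first exact: cvgI.
  by apply: nearW => n; have [_ + _] := sI n; exact.
- apply/cvg_lim => //.
  have -> : (fun n => I_ n (fun=> 1)) = (fun=> 1).
    by apply/funext => n; exact: state_cst.
  exact: cvg_cst.
Qed.

End states.

(** * Weak-* limits *)

Section weak_limits.
Variables (R : realType) (X : ptopologicalType).
Local Notation M := (g_sigma_algebraType (@open X)).

Lemma continuous_borel_measurable (f : X -> R) :
  continuous f -> measurable_fun setT (f : M -> R).
Proof.
move=> cf; apply: (measurability _ (RGenOInfty.measurableE R)).
move=> _ [_ [a ->] <-]; rewrite setTI; apply: sub_sigma_algebra.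
by apply: open_comp => //; exact: open_itv.
Qed.

(** The sum counts the positive integers strictly below [s], a number within one of [s]. Applied to
    a multiple of f(x), it is the pointwise form of the layer-cake decomposition. *)
Lemma count_lt_bounds (s : R) (n : nat) : 0 <= s -> s <= n%:R ->
  \sum_(k < n) (k.+1%:R < s)%R%:R <= s <= 1 + (\sum_(k < n) (k.+1%:R < s)%R%:R : R).
Proof.
elim: n s => [|n IH] s s0 sn.
  by rewrite big_ord0 addr0 s0 (le_trans sn) ?ler01.
rewrite big_ord_recl/=; have [s1|s1] := ltP 1 s; last first.
  rewrite add0r big1 ?addr0 ?s0// => i _; case: ltP => //= si.
  by have := lt_le_trans si s1; rewrite ltrn1.
have -> : \sum_(i < n) ((bump 0 i).+1%:R < s)%R%:R =
          \sum_(i < n) (i.+1%:R < s - 1)%R%:R :> R.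
  by apply: eq_bigr => i _; rewrite /bump/= add1n ltrBrDr -natr1.
have s0' : 0 <= s - 1 by lra.
have sn' : s - 1 <= n%:R by move: sn; rewrite -natr1; lra.
have := IH _ s0' sn'; set S := \sum_(_ < _) _ => /andP[S1 S2].
have -> : true%:R = 1 :> R by [].
by apply/andP; split; lra.
Qed.

(* Layer-cake decomposition of f over the open sets [k < n f]. *)
Lemma state_le_continuous (I J : (M -> R) -> R) (f : X -> R) :
  state I -> state J ->
  (forall U : set X, open U -> I \1_U <= J \1_U) ->
  continuous f -> (forall x, 0 <= f x <= 1) -> I f <= J f.
Proof.
move=> sI sJ IJ cf f01; apply/ler_addgt0Pr => e e0.
(* The layer-cake sum misses [n.+1 * f] by at most 1, hence [f] by at most [n.+1^-1]. *)
have [n ne] : exists n : nat, n.+1%:R^-1 < e.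
  have [n _ /(_ n (leqnn n))] := near_infty_natSinv_lt (PosNum e0).
  by exists n.
pose U (k : nat) := [set x : X | k.+1%:R < n.+1%:R * f x].
have oU k : open (U k).
  have -> : U k = f @^-1` [set y | k.+1%:R / n.+1%:R < y].
    by apply/seteqP; split=> x; rewrite /U/= ltr_pdivrMr ?ltr0n// mulrC.
  by apply: open_comp => //; exact: open_gt.
have bU k : bounded_measurable (\1_(U k) : M -> R).
  apply: bounded_measurable_indic; exact: sub_sigma_algebra.
have bf : bounded_measurable (f : M -> R).
  split; first exact: continuous_borel_measurable.
  by exists 1 => x; have /andP[? ?] := f01 x; rewrite ger0_norm.
have fU x : \sum_(k < n.+1) \1_(U k) x <= n.+1%:R * f x
    <= 1 + \sum_(k < n.+1) (\1_(U k) x : R).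
  have /andP[f0 f1] := f01 x.
  have := @count_lt_bounds (n.+1%:R * f x) n.+1.
  rewrite mulr_ge0// ler_piMr// => /(_ isT isT).
  suff E k : \1_(U k) x = (k.+1%:R < n.+1%:R * f x)%R%:R :> R.
    by under [in X in X -> _]eq_bigr do rewrite -E.
  by rewrite indicE /U mem_setE.
have bS : bounded_measurable (fun x : M => \sum_(k < n.+1) (\1_(U k) x : R)).
  exact: (@bounded_measurable_sum R _ M n.+1 (fun k => \1_(U k))).
have bnf : bounded_measurable (fun x : M => n.+1%:R * f x).
  by apply: bounded_measurableM => //; exact: bounded_measurable_cst.
have b1 := @bounded_measurable_cst R _ M 1.
have sumU (K : (M -> R) -> R) : state K -> K (fun x => \sum_(k < n.+1) \1_(U k) x) =
    \sum_(k < n.+1) K \1_(U k).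
  by move=> sK; exact: (state_sum _ sK bU).
have If : n.+1%:R * I f <= 1 + \sum_(k < n.+1) I \1_(U k).
  rewrite -(stateZ _ sI bf) -(sumU _ sI) -[X in X + _](state_cst 1 sI).
  rewrite -(stateD sI)//; apply: (le_state sI) => //.
    by have := bounded_measurable_lin 1 b1 bS; congr bounded_measurable;
      apply/funext => x; rewrite mul1r.
  by move=> x; have /andP[] := fU x.
have Jf : \sum_(k < n.+1) J \1_(U k) <= n.+1%:R * J f.
  rewrite -(stateZ _ sJ bf) -(sumU _ sJ); apply: (le_state sJ) => // x.
  by have /andP[] := fU x.
have IJf : n.+1%:R * I f <= 1 + n.+1%:R * J f.
  rewrite (le_trans If)// lerD2l (le_trans _ Jf)//.
  by apply: ler_sum => k _; exact: IJ.
have n0 : 0 < n.+1%:R :> R by rewrite ltr0n.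
rewrite -(ler_pM2l n0) (le_trans IJf)// mulrDr addrC lerD2l.
by rewrite -ler_pdivrMl// mulr1 ltW.
Qed.

(* The measure regularizes an ultrafilter limit of the states. *)
Lemma weak_limit_measure (I_ : nat -> (M -> R) -> R) :
  hausdorff_space X -> compact [set: X] -> (forall n, state (I_ n)) ->
  exists lam : {finite_measure set M -> \bar R},
  [/\ lam setT = 1%E,
      forall A : set M, measurable A ->
       lam A = ereal_inf [set lam U | U in [set U : set X | open U /\ A `<=` U]] /\
       lam A = ereal_sup [set lam K | K in [set K : set X | compact K /\ K `<=` A]]
    & forall (f : X -> R) c, continuous f -> (forall x, `|f x| <= 1) ->
       (fun n => I_ n f) @ \oo --> c -> Rintegral lam setT f = c].
Proof.
move=> hX kX sI_.
have [U [UU ooU]] := ultraFilterLemma eventually_filter.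
have [I [sI Icvg]] := state_ultralimit UU sI_.
have bi (A : set M) : measurable A -> bounded_measurable (\1_A : M -> R).
  exact: bounded_measurable_indic.
have [||||lam [lam1 lamreg lamI]] :=
  @exists_regularization R X hX kX (fun A : set M => I \1_A).
- by rewrite indic0; exact: state0.
- by rewrite indicT; exact: state_cst.
- move=> A B mA mB AB; apply: (le_state sI); [exact: bi|exact: bi|].
  move=> x; rewrite !indicE ler_nat; case: (boolP (x \in A)) => // xA.
  by rewrite mem_set//; apply: AB; rewrite inE in xA.
- move=> A B mA mB AB; rewrite -(stateD sI); [|exact: bi|exact: bi].
  congr I; apply/funext => x; rewrite !indicE in_setU.
  have [xA|xA] := boolP (x \in A); have [xB|xB] := boolP (x \in B);
    rewrite /= ?addr0 ?add0r//.
  by exfalso; rewrite !inE in xA, xB; have : (A `&` B) x by []; rewrite AB.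
exists lam; split => // f c cf f1 Ifc.
have bf : bounded_measurable (f : M -> R).
  by split; [exact: continuous_borel_measurable|exists 1].
have {Ifc}Ifc : I f = c.
  apply: (@cvg_unique _ (@Rhausdorff R) (nbhs ((fun n => I_ n f) @ U))).
    exact: Icvg.
  by apply: cvg_trans Ifc => A; exact: ooU.
have sl := state_Rintegral lam1.
have le (g : X -> R) : continuous g -> (forall x, `|g x| <= 1) ->
    Rintegral lam setT g <= I g.
  move=> cg g1; have bg : bounded_measurable (g : M -> R).
    by split; [exact: continuous_borel_measurable|exists 1].
  (* [state_le_continuous] needs values between 0 and 1. The map t |-> (t + 1)/2 brings the range of
     [g] there, and states commute with it. *)
  have cst2 := @bounded_measurable_cst R _ M (2^-1).
  have := @state_le_continuous _ _ (fun x => 2^-1 * g x + 2^-1) sl sI.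
  have [Ll _ _] := sl; have [Il _ _] := sI.
  rewrite (Ll _ _ _ bg cst2) (Il _ _ _ bg cst2) !state_cst//.
  rewrite lerD2r ler_pM2l ?invr_gt0//; apply.
  - move=> V oV; rewrite /Rintegral.
    rewrite integral_indic// ?setIT; last exact: sub_sigma_algebra.
    rewrite -lee_fin fineK; first exact: lamI.
    by apply: fin_num_measure; exact: sub_sigma_algebra.
  - move=> x; apply: cvgD; last exact: cvg_cst.
    by apply: cvgM; [exact: cvg_cst|exact: cg].
  - by move=> x; move: (g1 x); rewrite ler_norml => /andP[? ?]; lra.
(* [le] applied to [f] gives one inequality, applied to [- f] the other: this is where one-sided
   domination on open sets becomes equality. *)
apply/eqP; rewrite eq_le -Ifc le//=.
rewrite -lerN2 -mulN1r -[leRHS]mulN1r -(stateZ _ sI bf) -(stateZ _ sl bf).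
apply: le.
- by move=> x; apply: cvgM; [exact: cvg_cst|exact: cf].
- by move=> x; rewrite mulN1r normrN.
Qed.

End weak_limits.

(** * Complex integrals *)

Section complex_integral.
Local Open Scope complex_scope.
Variables (R : realType) (G : topologicalZmodType).
Local Notation M := (borel G).
Local Notation C := R[i].
Local Notation Re := (@complex.Re R).
Local Notation Im := (@complex.Im R).
Local Notation normc := Normc.normc.
Implicit Types (m mu : {measure set M -> \bar R}) (f g h : M -> C).

Lemma cReM (x y : C) : Re (x * y) = Re x * Re y - Im x * Im y.
Proof. by case: x y => [a b] [c d]. Qed.

Lemma cImM (x y : C) : Im (x * y) = Re x * Im y + Im x * Re y.
Proof. by case: x y => [a b] [c d]. Qed.

Lemma cReD (x y : C) : Re (x + y) = Re x + Re y.
Proof. by case: x y => [a b] [c d]. Qed.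

Lemma cImD (x y : C) : Im (x + y) = Im x + Im y.
Proof. by case: x y => [a b] [c d]. Qed.

Lemma cReJ (x : C) : Re (conjc x) = Re x.
Proof. by case: x. Qed.

Lemma cImJ (x : C) : Im (conjc x) = - Im x.
Proof. by case: x. Qed.

Lemma normc_sqr (x : C) : normc x ^+ 2 = Re x ^+ 2 + Im x ^+ 2.
Proof. by case: x => a b /=; rewrite sqr_sqrtr// addr_ge0// sqr_ge0. Qed.

Lemma normc_ge0 (x : C) : 0 <= normc x.
Proof. by case: x => a b; exact: sqrtr_ge0. Qed.

Lemma normc_conj (x : C) : normc (conjc x) = normc x.
Proof. by case: x => a b /=; rewrite sqrrN. Qed.

Lemma mul_conjc (x : C) : x * conjc x = (normc x ^+ 2)%:C.
Proof.
apply/eqP; rewrite eq_complex normc_sqr cReM cImM cReJ cImJ/=.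
by apply/andP; split; apply/eqP; ring.
Qed.

Lemma abs_Re_le (x : C) : `|Re x| <= normc x.
Proof.
rewrite -(@ler_pXn2r _ 2)// ?nnegrE ?normc_ge0//.
by rewrite -normrX ger0_norm ?sqr_ge0// normc_sqr lerDl sqr_ge0.
Qed.

Lemma abs_Im_le (x : C) : `|Im x| <= normc x.
Proof.
rewrite -(@ler_pXn2r _ 2)// ?nnegrE ?normc_ge0//.
by rewrite -normrX ger0_norm ?sqr_ge0// normc_sqr lerDr sqr_ge0.
Qed.

Definition cintegrable m f :=
  m.-integrable setT (EFin \o (Re \o f)) /\ m.-integrable setT (EFin \o (Im \o f)).

Definition cbounded f :=
  bounded_measurable (Re \o f) /\ bounded_measurable (Im \o f).

Lemma cintegral_lin_integrable m (a : C) f g :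
  cintegrable m f -> cintegrable m g ->
  cintegrable m (fun x => a * f x + g x) /\
  cintegral m (fun x => a * f x + g x) = a * cintegral m f + cintegral m g.
Proof.
move=> [fR fI] [gR gI].
have [iR eR] := Rintegral_lin (Re a) (- Im a) fR fI gR.
have [iI eI] := Rintegral_lin (Im a) (Re a) fR fI gI.
have ER : Re \o (fun x => a * f x + g x) =
    (fun x => Re a * (Re \o f) x + - Im a * (Im \o f) x + (Re \o g) x).
  by apply/funext => x /=; rewrite cReD cReM mulNr.
have EI : Im \o (fun x => a * f x + g x) =
    (fun x => Im a * (Re \o f) x + Re a * (Im \o f) x + (Im \o g) x).
  by apply/funext => x /=; rewrite cImD cImM [X in X + _]addrC.
split; first by split; rewrite ?ER ?EI.
rewrite /cintegral -[X in Rintegral m setT X +i* _]/(Re \o _) ER eR.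
rewrite -[X in _ +i* Rintegral m setT X]/(Im \o _) EI eI.
apply/eqP; rewrite eq_complex/= cReD cImD cReM cImM/= mulNr !eqxx/=.
by rewrite [X in _ == X + _]addrC.
Qed.

Lemma cintegrable_lin m (a : C) f g : cintegrable m f -> cintegrable m g ->
  cintegrable m (fun x => a * f x + g x).
Proof. by move=> /cintegral_lin_integrable h /h -/(_ a)[]. Qed.

Lemma cintegral_lin m (a : C) f g : cintegrable m f -> cintegrable m g ->
  cintegral m (fun x => a * f x + g x) = a * cintegral m f + cintegral m g.
Proof. by move=> /cintegral_lin_integrable h /h -/(_ a)[]. Qed.

Lemma cintegrable0 m : cintegrable m (fun=> 0).
Proof. by split; exact: integrable0. Qed.

Lemma cintegral0 m : cintegral m (fun=> 0) = 0.
Proof. by rewrite /cintegral/= /Rintegral !integral0. Qed.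

Lemma cintegrableZ m (a : C) f : cintegrable m f -> cintegrable m (fun x => a * f x).
Proof.
move=> fi; have := cintegrable_lin a fi (cintegrable0 m).
by congr cintegrable; apply/funext => x; rewrite addr0.
Qed.

Lemma cintegralZ m (a : C) f : cintegrable m f ->
  cintegral m (fun x => a * f x) = a * cintegral m f.
Proof.
move=> fi; have := cintegral_lin a fi (cintegrable0 m).
by rewrite cintegral0 addr0 => <-; congr cintegral; apply/funext => x; rewrite addr0.
Qed.

Lemma cintegral_sum_integrable m n (F : nat -> M -> C) :
  (forall k, (k < n)%N -> cintegrable m (F k)) ->
  cintegrable m (fun x => \sum_(k < n) F k x) /\
  cintegral m (fun x => \sum_(k < n) F k x) = \sum_(k < n) cintegral m (F k).
Proof.
elim: n => [|n IH] iF.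
  under eq_fun do rewrite big_ord0; rewrite big_ord0 cintegral0.
  by split=> //; exact: cintegrable0.
have [iS eS] : cintegrable m (fun x => \sum_(k < n) F k x) /\
  cintegral m (fun x => \sum_(k < n) F k x) = \sum_(k < n) cintegral m (F k).
  by apply: IH => k kn; apply: iF; rewrite ltnS ltnW.
have [] := cintegral_lin_integrable 1 (iF n (ltnSn n)) iS.
have -> : (fun x => 1 * F n x + \sum_(k < n) F k x) =
          (fun x => \sum_(k < n.+1) F k x).
  by apply/funext => x; rewrite big_ord_recr/= mul1r addrC.
by move=> ? ->; split=> //; rewrite eS mul1r big_ord_recr addrC.
Qed.

Lemma cintegrable_sum m n (F : nat -> M -> C) :
  (forall k, (k < n)%N -> cintegrable m (F k)) ->
  cintegrable m (fun x => \sum_(k < n) F k x).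
Proof. by move=> /cintegral_sum_integrable[]. Qed.

Lemma cintegral_sum m n (F : nat -> M -> C) :
  (forall k, (k < n)%N -> cintegrable m (F k)) ->
  cintegral m (fun x => \sum_(k < n) F k x) = \sum_(k < n) cintegral m (F k).
Proof. by move=> /cintegral_sum_integrable[]. Qed.

Lemma cintegral_conj m f : cintegrable m f ->
  cintegral m (fun x => conjc (f x)) = conjc (cintegral m f).
Proof.
move=> [fR fI]; rewrite /cintegral/=; congr (_ +i* _).
  by apply: eq_Rintegral => x _; rewrite cReJ.
rewrite -[RHS]mulN1r -RintegralZl//.
by apply: eq_Rintegral => x _; rewrite cImJ mulN1r.
Qed.

Lemma cbounded_integrable m f : (m setT < +oo)%E -> cbounded f -> cintegrable m f.
Proof. by move=> moo [fR fI]; split; exact: bounded_measurable_integrable. Qed.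

Lemma cbounded_cst c : cbounded (fun=> c).
Proof. by split; exact: bounded_measurable_cst. Qed.

Lemma bounded_measurableD (u v : M -> R) : bounded_measurable u ->
  bounded_measurable v -> bounded_measurable (fun x => u x + v x).
Proof.
move=> bu bv; have := bounded_measurable_lin 1 bu bv.
by congr bounded_measurable; apply/funext => x; rewrite mul1r.
Qed.

Lemma bounded_measurableN (u : M -> R) : bounded_measurable u ->
  bounded_measurable (fun x => - u x).
Proof.
move=> bu; have := bounded_measurableM (bounded_measurable_cst _ (-1)) bu.
by congr bounded_measurable; apply/funext => x; rewrite mulN1r.
Qed.

Lemma cboundedD f g : cbounded f -> cbounded g -> cbounded (fun x => f x + g x).
Proof.
move=> [fR fI] [gR gI]; split.
  by have := bounded_measurableD fR gR; congr bounded_measurable;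
    apply/funext => x /=; rewrite cReD.
by have := bounded_measurableD fI gI; congr bounded_measurable;
  apply/funext => x /=; rewrite cImD.
Qed.

Lemma cboundedM f g : cbounded f -> cbounded g -> cbounded (fun x => f x * g x).
Proof.
move=> [fR fI] [gR gI]; split.
  have := bounded_measurableD (bounded_measurableM fR gR)
    (bounded_measurableN (bounded_measurableM fI gI)).
  by congr bounded_measurable; apply/funext => x /=; rewrite cReM.
have := bounded_measurableD (bounded_measurableM fR gI)
    (bounded_measurableM fI gR).
by congr bounded_measurable; apply/funext => x /=; rewrite cImM.
Qed.

Lemma cbounded_conj f : cbounded f -> cbounded (fun x => conjc (f x)).
Proof.
move=> [fR fI]; split.
  by move: fR; congr bounded_measurable; apply/funext => x /=; rewrite cReJ.
by have := bounded_measurableN fI; congr bounded_measurable; apply/funext => x /=;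
  rewrite cImJ.
Qed.

Lemma cboundedX f n : cbounded f -> cbounded (fun x => f x ^+ n).
Proof.
move=> bf; elim: n => [|n IH].
  by under eq_fun do rewrite expr0; exact: cbounded_cst.
by under eq_fun do rewrite exprS; exact: cboundedM.
Qed.

Lemma cbounded_sum n (F : nat -> M -> C) : (forall k, cbounded (F k)) ->
  cbounded (fun x => \sum_(k < n) F k x).
Proof.
move=> bF; elim: n => [|n IH].
  by under eq_fun do rewrite big_ord0; exact: cbounded_cst.
by under eq_fun do rewrite big_ord_recr/=; exact: cboundedD.
Qed.

Lemma bounded_measurable_integrableM m (u v : M -> R) :
  bounded_measurable u -> m.-integrable setT (EFin \o v) ->
  m.-integrable setT (EFin \o (fun x => u x * v x)).
Proof.
move=> [mu_ [B uB]] iv; have := integrableMr measurableT mu_ _ iv; apply.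
exists B; split; first exact: num_real.
by move=> N BN x _ /=; rewrite (le_trans (uB x))// ltW.
Qed.

Lemma cintegrableM m f h : cbounded f -> cintegrable m h ->
  cintegrable m (fun x => f x * h x).
Proof.
move=> [fR fI] [hR hI]; split.
  have [+ _] := Rintegral_lin 1 (-1) (bounded_measurable_integrableM fR hR)
    (bounded_measurable_integrableM fI hI) (integrable0 m setT).
  by congr (m.-integrable _ _); apply/funext => x /=; rewrite cReM mul1r mulN1r addr0.
have [+ _] := Rintegral_lin 1 1 (bounded_measurable_integrableM fR hI)
    (bounded_measurable_integrableM fI hR) (integrable0 m setT).
by congr (m.-integrable _ _); apply/funext => x /=; rewrite cImM !mul1r addr0.
Qed.

Lemma L2_cintegrable m h : (m setT < +oo)%E -> L2 m h -> cintegrable m h.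
Proof.
move=> moo [[hR hI] h2].
have i1 := bounded_measurable_integrable moo (bounded_measurable_cst _ (1 : R)).
have i12 : m.-integrable setT (EFin \o (fun x : M => 1 + normc (h x) ^+ 2)).
  exact: (integrable_add i1 h2).
have le (x : M) : normc (h x) <= 1 + normc (h x) ^+ 2.
  have := normc_ge0 (h x); set t := normc _ => t0; nra.
split; apply: le_integrable i12 => //.
- exact/measurable_EFinP.
- move=> x _ /=; rewrite lee_fin (le_trans (abs_Re_le _))// (le_trans (le x))//.
  exact: ler_norm.
- exact/measurable_EFinP.
- move=> x _ /=; rewrite lee_fin (le_trans (abs_Im_le _))// (le_trans (le x))//.
  exact: ler_norm.
Qed.

Lemma normc_sqr_bounded f : cbounded f ->
  bounded_measurable (fun x => normc (f x) ^+ 2).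
Proof.
move=> [fR fI].
have := bounded_measurableD (bounded_measurableM fR fR) (bounded_measurableM fI fI).
by congr bounded_measurable; apply/funext => x /=; rewrite normc_sqr !expr2.
Qed.

Lemma normc_bounded f : cbounded f -> bounded_measurable (fun x => normc (f x)).
Proof.
move=> bf; have [mf [B fB]] := normc_sqr_bounded bf; split.
  have -> : (fun x => normc (f x)) = Num.sqrt \o (fun x => normc (f x) ^+ 2).
    by apply/funext => x /=; rewrite sqrtr_sqr ger0_norm ?normc_ge0.
  apply: measurableT_comp => //.
  apply: continuous_measurable_fun; exact: sqrt_continuous.
exists (1 + B) => x; have := fB x; rewrite !ger0_norm ?sqr_ge0 ?normc_ge0//.
have := normc_ge0 (f x); set t := normc _ => t0; nra.
Qed.

Lemma normc_measurable f : cmeasurable f -> measurable_fun setT (fun x => normc (f x)).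
Proof.
move=> [fR fI].
have -> : (fun x => normc (f x)) = Num.sqrt \o (fun x => Re (f x) ^+ 2 + Im (f x) ^+ 2).
  by apply/funext => x /=; rewrite -normc_sqr sqrtr_sqr ger0_norm ?normc_ge0.
apply: measurableT_comp => //.
  apply: continuous_measurable_fun; exact: sqrt_continuous.
by apply: measurable_funD; apply: measurable_funX.
Qed.

Lemma cbounded_L2 m f : (m setT < +oo)%E -> cbounded f -> L2 m f.
Proof.
move=> moo bf; split; first by case: bf => [[? _] [? _]].
exact: (bounded_measurable_integrable moo (normc_sqr_bounded bf)).
Qed.

Lemma cbounded_L1 m f : (m setT < +oo)%E -> cbounded f -> L1 m f.
Proof.
move=> moo bf; split; first by case: bf => [[? _] [? _]].
exact: (bounded_measurable_integrable moo (normc_bounded bf)).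
Qed.

(** The duality of L^1 with bounded functions, used to bound an L^1 norm from below. The real part
    is enough because the pairing computed later is a real number. *)
Lemma Re_cintegral_le m f g (K : R) : (m setT < +oo)%E -> cbounded f -> cbounded g ->
  (forall x, normc (g x) <= K) ->
  Re (cintegral m (fun x => f x * g x)) <= K * L1norm m f.
Proof.
move=> moo bf bg gK; have bfg := cboundedM bf bg.
have iF := bounded_measurable_integrable moo (normc_bounded bf).
rewrite /L1norm -RintegralZl//=; apply: le_Rintegral => //.
- exact: bounded_measurable_integrable bfg.1.
- exact: integrable_scale.
- move=> x _; rewrite (le_trans (ler_norm _))// (le_trans (abs_Re_le _))//.
  by rewrite Normc.normcM mulrC ler_wpM2r ?normc_ge0.
Qed.

Lemma L1norm_ae_eq m f g : cmeasurable f -> cmeasurable g ->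
  {ae m, forall x, f x = g x} -> L1norm m f = L1norm m g.
Proof.
move=> mf mg fg; rewrite /L1norm /Rintegral; congr fine.
apply: ae_eq_integral => //.
- by apply/measurable_EFinP; exact: normc_measurable.
- by apply/measurable_EFinP; exact: normc_measurable.
- by apply: filterS fg => x fgx _; rewrite fgx.
Qed.

End complex_integral.

(** * Characters *)

Section characters.
Local Open Scope complex_scope.
Variables (R : realType) (G : topologicalZmodType).
Local Notation M := (borel G).
Local Notation C := R[i].
Local Notation Re := (@complex.Re R).
Local Notation Im := (@complex.Im R).
Local Notation normc := Normc.normc.
Implicit Types (mu : {measure set M -> \bar R}) (chi eta : G -> C).

Definition ccontinuous (f : G -> C) :=
  continuous (fun x => Re (f x)) /\ continuous (fun x => Im (f x)).

Lemma ccontinuousD f g : ccontinuous f -> ccontinuous g ->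
  ccontinuous (fun x => f x + g x).
Proof.
move=> [fR fI] [gR gI]; split=> x.
  by under eq_fun do rewrite cReD; apply: cvgD; [exact: fR|exact: gR].
by under eq_fun do rewrite cImD; apply: cvgD; [exact: fI|exact: gI].
Qed.

Lemma ccontinuousM f g : ccontinuous f -> ccontinuous g ->
  ccontinuous (fun x => f x * g x).
Proof.
move=> [fR fI] [gR gI]; split=> x.
  under eq_fun do rewrite cReM.
  apply: cvgB; (apply: cvgM; [|]); [exact: fR|exact: gR|exact: fI|exact: gI].
under eq_fun do rewrite cImM.
apply: cvgD; (apply: cvgM; [|]); [exact: fR|exact: gI|exact: fI|exact: gR].
Qed.

Lemma ccontinuousJ f : ccontinuous f -> ccontinuous (fun x => conjc (f x)).
Proof.
move=> [fR fI]; split=> x.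
  by under eq_fun do rewrite cReJ; exact: fR.
by under eq_fun do rewrite cImJ; apply: cvgN; exact: fI.
Qed.

Lemma ccontinuous_cst (c : C) : ccontinuous (fun=> c).
Proof. by split=> x; exact: cvg_cst. Qed.

Lemma ccontinuous_sum n (F : nat -> G -> C) : (forall k, ccontinuous (F k)) ->
  ccontinuous (fun x => \sum_(k < n) F k x).
Proof.
move=> cF; elim: n => [|n IH].
  by under eq_fun do rewrite big_ord0; exact: ccontinuous_cst.
by under eq_fun do rewrite big_ord_recr/=; exact: ccontinuousD.
Qed.

Lemma characterM chi eta : character chi -> character eta ->
  character (fun x => chi x * eta x).
Proof.
move=> [cM c1 cc] [eM e1 ec]; split=> [x y|x|].
- by rewrite cM eM mulrACA.
- by rewrite Normc.normcM c1 e1 mulr1.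
- exact: ccontinuousM.
Qed.

Lemma characterJ chi : character chi -> character (fun x => conjc (chi x)).
Proof.
move=> [cM c1 cc]; split=> [x y|x|].
- by rewrite cM rmorphM.
- by rewrite normc_conj c1.
- exact: ccontinuousJ.
Qed.

Lemma character1 : character (@ctriv R G).
Proof.
split=> [x y|x|]; [by rewrite mulr1|exact: Normc.normc1|exact: ccontinuous_cst].
Qed.

Lemma characterX chi n : character chi -> character (fun x => chi x ^+ n).
Proof.
move=> cchi; elim: n => [|n IH]; first by under eq_fun do rewrite expr0; exact: character1.
by under eq_fun do rewrite exprS; exact: characterM.
Qed.

Lemma character_mulJ chi x : character chi -> chi x * conjc (chi x) = 1.
Proof. by move=> [_ c1 _]; rewrite mul_conjc c1 expr1n. Qed.

Lemma character0 chi : character chi -> chi 0 = 1.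
Proof.
move=> cchi; have [cM _ _] := cchi.
have := cM 0 0; rewrite addr0 => e.
by rewrite -[LHS]mulr1 -[X in _ * X](character_mulJ 0 cchi) mulrA -e character_mulJ.
Qed.

Lemma character_mulJ_triv chi eta : character chi -> character eta ->
  (fun x => chi x * conjc (eta x)) = @ctriv R G -> chi = eta.
Proof.
move=> cchi ceta /funeqP h; apply/funext => x.
rewrite -[LHS]mulr1 -(character_mulJ x ceta) [eta x * _]mulrC mulrA.
by have /= -> := h x; rewrite mul1r.
Qed.

Lemma character_cbounded chi : character chi -> cbounded (chi : M -> C).
Proof.
move=> [_ c1 [cR cI]]; split; split.
- exact: (@continuous_borel_measurable R (zpt G)).
- by exists 1 => x; rewrite -(c1 x); exact: abs_Re_le.
- exact: (@continuous_borel_measurable R (zpt G)).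
- by exists 1 => x; rewrite -(c1 x); exact: abs_Im_le.
Qed.

(* On the kernel of chi the geometric sum of the chi^k is n, elsewhere it
   vanishes; hence the kernel is clopen. *)
Lemma character_torsion_free chi n : connected [set: G] -> character chi ->
  (0 < n)%N -> (fun x => chi x ^+ n) = @ctriv R G -> chi = @ctriv R G.
Proof.
move=> conG cchi n0 /funeqP chin.
pose S x := \sum_(k < n) chi x ^+ k.
have [cS _] : ccontinuous S.
  apply: (@ccontinuous_sum n (fun k x => chi x ^+ k)) => k.
  by have [_ _] := characterX k cchi.
have S1 x : chi x = 1 -> Re (S x) = n%:R.
  move=> c1; rewrite /S; under eq_bigr do rewrite c1 expr1n.
  by rewrite sumr_const card_ord -(rmorph_nat (real_complex R)).
have S0 x : chi x <> 1 -> S x = 0.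
  move=> /eqP c1; have := subrX1 (chi x) n; rewrite -/(S x).
  have /= -> := chin x; rewrite subrr => /esym/eqP.
  by rewrite mulf_eq0 subr_eq0 (negbTE c1) => /eqP.
(* [Re (S x)] takes only the values 0 and [n], with [n >= 1], so any threshold strictly between 0
   and 1 separates them. The strict form shows that the kernel is open, the large form that it is
   closed. *)
have kerE x : chi x = 1 <-> (2^-1 : R) < Re (S x).
  split=> [/S1 ->|]; first by rewrite (@lt_le_trans _ _ 1)// ?ler1n// invf_lt1// ltr1n.
  by move=> hS; apply: contrapT => /S0 S0x; move: hS; rewrite S0x/= ltNge invr_ge0 ler0n.
have kerE' x : chi x = 1 <-> (2^-1 : R) <= Re (S x).
  split=> [/kerE/ltW//|]; move=> hS; apply: contrapT => /S0 S0x.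
  by move: hS; rewrite S0x/= leNgt invr_gt0 ltr0n.
have kerT : [set x | chi x = 1] = [set: G].
  apply: conG.
  - by exists 0; exact: character0.
  - exists ((fun x => Re (S x)) @^-1` [set y | 2^-1 < y]).
      by apply: open_comp => //; exact: open_gt.
    by rewrite setTI; apply/seteqP; split=> x /kerE.
  - exists ((fun x => Re (S x)) @^-1` [set y | 2^-1 <= y]).
      by apply: closed_comp => //; exact: closed_ge.
    by rewrite setTI; apply/seteqP; split=> x /kerE'.
by apply/funext => x; have : [set: G] x by []; rewrite -kerT.
Qed.

(** * Translation invariance and orthogonality of characters *)

Section haar.
Variable mu : {measure set M -> \bar R}.
Hypothesis haar : normalized_haar mu.

Lemma haar_finite : (mu setT < +oo)%E.
Proof. by have [-> _ _] := haar; rewrite ltry. Qed.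

Lemma translation_measurable (a : G) :
  measurable_fun setT ((fun x => a + x) : M -> M).
Proof.
apply: (@measurability _ _ M M setT _ (@open (zpt G))) => // _ [U oU <-]; rewrite setTI.
apply: sub_sigma_algebra; move: oU; apply: (@open_comp G G) => x _.
apply: (@continuous_comp G (G * G)%type G (fun x => (a, x)) (fun p => p.1 + p.2)).
  by apply: cvg_pair; [exact: cvg_cst|exact: cvg_id].
exact: add_continuous.
Qed.

Lemma Rintegral_translation (a : G) (f : M -> R) : bounded_measurable f ->
  Rintegral mu setT (fun x => f (a + x)) = Rintegral mu setT f.
Proof.
move=> bf; have [mf [B fB]] := bf; have ma := translation_measurable a.
have bfa : bounded_measurable (fun x : M => f (a + x)).
  by split; [exact: measurableT_comp mf ma|exists B].
have ia := bounded_measurable_integrable haar_finite bfa.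
have mEf : measurable_fun [set: M] (EFin \o f) by exact/measurable_EFinP.
have e := @integral_pushforward _ _ _ _ _ _ ma mu setT (EFin \o f) mEf ia measurableT.
rewrite /Rintegral; congr fine.
rewrite -[LHS]/(integral mu _ ((EFin \o f) \o (fun x => a + x))).
rewrite -[X in integral mu X _](preimage_setT (fun x => a + x)) -e.
apply: eq_measure_integral => A mA _; rewrite /pushforward.
have [_ _ inv] := haar; rewrite -(inv (- a) A mA); congr (mu _).
apply/seteqP; split=> x /=; first by move=> Ax; exists (a + x) => //; rewrite addKr.
by move=> [y Ay <-]; rewrite addNKr.
Qed.

(** Translating by a point [a] with [chi a <> 1] multiplies the integral by [chi a] without changing
    it. *)
Lemma cintegral_character chi : character chi -> chi <> @ctriv R G ->
  cintegral mu chi = 0.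
Proof.
move=> cchi chi1; have bchi := character_cbounded cchi.
have [a chia] : exists a, chi a <> 1.
  by apply: contra_notP chi1 => /forallNP h; apply/funext => x;
    exact: contrapT (h x).
have : cintegral mu chi = chi a * cintegral mu chi.
  rewrite -cintegralZ; last exact: cbounded_integrable haar_finite bchi.
  have [cM _ _] := cchi; under [in RHS]eq_fun do rewrite -cM.
  rewrite /cintegral; congr (_ +i* _).
    exact: (esym (Rintegral_translation a bchi.1)).
  exact: (esym (Rintegral_translation a bchi.2)).
move=> /eqP; rewrite -{1}[cintegral mu chi]mul1r -subr_eq0 -mulrBl mulf_eq0.
by rewrite subr_eq0 eq_sym => /orP[/eqP //|/eqP].
Qed.

End haar.
End characters.

(** * Uniformly bounded sine sums *)

Section sine_sums.
Local Open Scope complex_scope.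
Variable R : realType.
Local Notation C := R[i].
Local Notation normc := (@Normc.normc R).
Implicit Types z : C.

Lemma normc_nat n : normc n%:R = n%:R.
Proof. by rewrite normcMn Normc.normc1. Qed.

Lemma normc_sum_le m n (F : nat -> C) (b : nat -> R) :
  (forall k, normc (F k) <= b k) ->
  normc (\sum_(m <= k < n) F k) <= \sum_(m <= k < n) b k.
Proof.
move=> Fb; elim/big_rec2: _ => [|k x y _ xy]; first by rewrite Normc.normc0.
by rewrite (le_trans (le_normcD _ _))// lerD.
Qed.

Lemma normcX z n : normc z = 1 -> normc (z ^+ n) = 1.
Proof.
move=> z1; elim: n => [|n IH]; first by rewrite expr0 Normc.normc1.
by rewrite exprS Normc.normcM z1 IH mulr1.
Qed.

Lemma normc_1subX z n : normc z = 1 -> normc (1 - z ^+ n) <= n%:R * normc (1 - z).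
Proof.
move=> z1; elim: n => [|n IH]; first by rewrite expr0 subrr Normc.normc0 mul0r.
have -> : 1 - z ^+ n.+1 = (1 - z ^+ n) + z ^+ n * (1 - z) by rewrite exprSr; ring.
rewrite (le_trans (le_normcD _ _))// Normc.normcM normcX// mul1r.
by rewrite -natr1 mulrDl mul1r lerD2r.
Qed.

(** The factor [1 - z] turns the sum into one over differences of decreasing coefficients, which
    costs at most twice the first coefficient. Tails are therefore bounded by 2 as soon as
    [m.+1 * normc (1 - z) >= 1]. *)
Lemma abel_tail z m n : normc z = 1 ->
  normc (1 - z) * normc (\sum_(m <= k < m + n) k.+1%:R^-1 * z ^+ k.+1) <=
  2 / m.+1%:R.
Proof.
move=> z1; rewrite -Normc.normcM.
set S := fun n => (1 - z) * \sum_(m <= k < m + n) k.+1%:R^-1 * z ^+ k.+1.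
(* The corrected sum A telescopes (Abel summation). *)
pose A n := S n + (m + n).+1%:R^-1 * z ^+ (m + n).+1.
have nV k : normc (k.+1%:R^-1 : C) = k.+1%:R^-1 by rewrite Normc.normcV normc_nat.
(* The subtracted term makes the induction telescope, and at the end it pays for returning from
   [A n] to [S n]. *)
have A_le k : normc (A k) <= 2 / m.+1%:R - (m + k).+1%:R^-1.
  elim: k => [|k IH].
    rewrite /A /S addn0 big_geq// mulr0 add0r Normc.normcM normcX// mulr1 nV.
    by rewrite lerBrDr mulr_natl mulr2n.
  have AS : A k.+1 = A k + ((m + k).+2%:R^-1 - (m + k).+1%:R^-1) * z ^+ (m + k).+2.
    rewrite /A /S addnS big_nat_recr ?leq_addr//= mulrDr [z ^+ (m + k).+2]exprS.
    by move: (\sum_(_ <= _ < _) _) => s; ring.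
  have d0 : (m + k).+2%:R^-1 <= (m + k).+1%:R^-1 :> R.
    by rewrite lef_pV2 ?posrE ?ltr0n// ler_nat.
  have dn : normc ((m + k).+2%:R^-1 - (m + k).+1%:R^-1 : C) =
      (m + k).+1%:R^-1 - (m + k).+2%:R^-1.
    have -> : (m + k).+2%:R^-1 - (m + k).+1%:R^-1 =
       ((m + k).+2%:R^-1 - (m + k).+1%:R^-1 : R)%:C.
      by rewrite rmorphB !fmorphV !rmorph_nat.
    by rewrite /= expr0n/= addr0 sqrtr_sqr distrC ger0_norm// subr_ge0.
  rewrite AS (le_trans (le_normcD _ _))// Normc.normcM normcX// mulr1 dn addnS.
  by rewrite (le_trans (lerD IH (lexx _)))// addrA subrK lexx.
rewrite -[X in normc X]/(S n).
have -> : S n = A n - (m + n).+1%:R^-1 * z ^+ (m + n).+1 by rewrite /A addrK.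
rewrite (le_trans (le_normcD _ _))// normcN Normc.normcM normcX// mulr1 nV.
by rewrite -lerBrDr; exact: A_le.
Qed.

(* sum_k sin(kt)/k is bounded uniformly: split the sum at 1/t *)
Lemma sine_sum_bound z n : normc z = 1 ->
  normc (\sum_(k < n) k.+1%:R^-1 * (conjc z ^+ k.+1 - z ^+ k.+1)) <= 6.
Proof.
move=> z1; set w := conjc z; have w1 : normc w = 1 by rewrite /w normc_conj.
rewrite -(big_mkord xpredT (fun k => k.+1%:R^-1 * (w ^+ k.+1 - z ^+ k.+1))).
set d := normc (1 - z).
have dw : normc (1 - w) = d by rewrite /d -[RHS]normc_conj rmorphB rmorph1.
have d0 : 0 <= d by exact: normc_ge0.
have term k : normc (k.+1%:R^-1 * (w ^+ k.+1 - z ^+ k.+1)) <= 2 * d.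
  rewrite Normc.normcM Normc.normcV normc_nat ler_pdivrMl ?ltr0n//.
  have -> : w ^+ k.+1 - z ^+ k.+1 = (1 - z ^+ k.+1) - (1 - w ^+ k.+1) by ring.
  rewrite (le_trans (le_normcD _ _))// normcN.
  have := normc_1subX k.+1 z1; have := normc_1subX k.+1 w1; rewrite dw -/d.
  by lra.
have head p q : (p <= q)%N ->
    normc (\sum_(p <= k < q) k.+1%:R^-1 * (w ^+ k.+1 - z ^+ k.+1)) <= (q - p)%:R * (2 * d).
  move=> pq; rewrite (le_trans (normc_sum_le _ _ term))//.
  by rewrite sumr_const_nat -[leLHS]mulr_natl lexx.
have [dE|dN] := eqVneq d 0.
  by rewrite (le_trans (head 0%N n _))// dE !mulr0.
have dp : 0 < d by rewrite lt_neqAle eq_sym dN.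
(* The cutoff at which both estimates are good. Below it each term is at most [2 * d], the [1/k]
   cancelling the factor [k] of [normc_1subX], so the head is at most [2 * (m * d) <= 2]. Above it
   the tails in [z] and in [w] are at most 2 each, whence the constant 6. *)
pose m := Num.truncn d^-1.
have [m1 m2] : m%:R * d <= 1 /\ 1 <= m.+1%:R * d.
  have /truncn_itv/andP[mle mgt] : 0 <= d^-1 by rewrite invr_ge0.
  have d1 := mulVf dN; split.
    by rewrite -[leRHS]d1 ler_pM2r.
  by rewrite -[leLHS]d1 ler_pM2r// ltW.
have tail u p : normc u = 1 -> normc (1 - u) = d ->
    normc (\sum_(m <= k < m + p) k.+1%:R^-1 * u ^+ k.+1) <= 2.
  move=> u1 ud; have := abel_tail m p u1; rewrite ud.
  have m0 : 0 < m.+1%:R :> R by rewrite ltr0n.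
  rewrite ler_pdivlMr//; set t := normc _ => td.
  have t0 : 0 <= t by exact: normc_ge0.
  apply: le_trans td; rewrite mulrAC mulrC [d * _]mulrC; exact: ler_peMr.
have [nm|mn] := leqP n m.
  rewrite (le_trans (head 0%N n _))// subn0.
  have : n%:R * d <= 1.
    by rewrite (le_trans _ m1)// ler_wpM2r// ler_nat.
  lra.
rewrite (big_cat_nat (leq0n m) (ltnW mn))/= (le_trans (le_normcD _ _))//.
have h1 := head 0%N m (leq0n m); rewrite subn0 in h1.
have h2 : normc (\sum_(m <= k < n) k.+1%:R^-1 * (w ^+ k.+1 - z ^+ k.+1)) <= 4.
  under eq_bigr do rewrite mulrBr.
  rewrite sumrB (le_trans (le_normcD _ _))// normcN.
  have := tail z (n - m)%N z1 erefl; have := tail w (n - m)%N w1 dw.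
  rewrite subnKC ?(ltnW mn)//; lra.
by move: h1 h2 m1; lra.
Qed.

End sine_sums.

(** * Trigonometric sums in a character *)

Section trigonometric_sums.
Local Open Scope complex_scope.
Variables (R : realType) (G : topologicalZmodType).
Local Notation M := (borel G).
Local Notation C := R[i].
Local Notation Re := (@complex.Re R).
Local Notation Im := (@complex.Im R).
Local Notation normc := (@Normc.normc R).
Variables (mu : {measure set M -> \bar R}) (chi : G -> C).
Hypotheses (haar : normalized_haar mu) (cchi : character chi).
Hypothesis chi_free : forall n, (0 < n)%N -> (fun x => chi x ^+ n) <> @ctriv R G.

(* chi^(i-j), without negative exponents *)
Definition pw i j (x : G) : C := chi x ^+ i * conjc (chi x) ^+ j.

(** Indexing by pairs instead of the exponent i - j gives the Fejer kernel constant coefficients: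
    the weight N - |k| of chi^k is the number of pairs with difference k. Truncating to nonnegative
    powers means keeping the triangle j <= i. *)
Definition pwsum N (c : nat -> nat -> C) (x : G) : C :=
  \sum_(i < N) \sum_(j < N) c i j * pw i j x.

Lemma pw_character i j : character (pw i j).
Proof. by apply: characterM; apply: characterX => //; exact: characterJ. Qed.

Lemma pw_cbounded i j : cbounded (pw i j : M -> C).
Proof. exact/character_cbounded/pw_character. Qed.

Lemma pw_add i j k : pw (i + k) (j + k) = pw i j.
Proof.
apply/funext => x; rewrite /pw !exprD mulrACA -exprMn character_mulJ// expr1n.
by rewrite mulr1.
Qed.

Lemma pw_ge i j : (j <= i)%N -> pw i j = fun x => chi x ^+ (i - j).
Proof.
move=> ji; rewrite -{1}(subnK ji) -[X in pw _ X]add0n pw_add.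
by apply/funext => x; rewrite /pw expr0 mulr1.
Qed.

Lemma pw_le i j : (i <= j)%N -> pw i j = fun x => conjc (chi x) ^+ (j - i).
Proof.
move=> ij; rewrite -{1}(subnK ij) -[X in pw X _]add0n pw_add.
by apply/funext => x; rewrite /pw expr0 mul1r.
Qed.

Lemma cintegral_triv : cintegral mu (@ctriv R G) = 1.
Proof.
have [mu1 _ _] := haar; rewrite /cintegral /ctriv/= !Rintegral_cst//.
by rewrite mul0r mu1 mulr1.
Qed.

Lemma cintegral_pw i j : cintegral mu (pw i j) = (i == j)%:R.
Proof.
have [->|ij] := eqVneq i j.
  by rewrite pw_ge// subnn -[RHS]cintegral_triv.
apply: cintegral_character => //; first exact: pw_character.
move: ij; rewrite neq_ltn => /orP[ij|ji].
  rewrite pw_le ?(ltnW ij)// => h; apply: (@chi_free (j - i)).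
    by rewrite subn_gt0.
  apply/funext => x; have /(congr1 conjc) := congr1 (@^~ x) h.
  by rewrite /= rmorphXn/= conjcK => ->; exact: conjc1.
by rewrite pw_ge ?(ltnW ji)//; apply: chi_free; rewrite subn_gt0.
Qed.

Lemma pwsum_cbounded N c : cbounded (pwsum N c : M -> C).
Proof.
apply: (@cbounded_sum R G N (fun i x => \sum_(j < N) c i j * pw i j x)) => i.
apply: (@cbounded_sum R G N (fun j x => c i j * pw i j x)) => j.
by apply: cboundedM; [exact: cbounded_cst|exact: pw_cbounded].
Qed.

Lemma cintegral_pwsum N c (theta : M -> C) : cintegrable mu theta ->
  cintegral mu (fun x => pwsum N c x * theta x) =
  \sum_(i < N) \sum_(j < N) c i j * cintegral mu (fun x => pw i j x * theta x).
Proof.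
move=> ith.
have it i j : cintegrable mu (fun x => pw i j x * theta x).
  by apply: cintegrableM => //; exact: pw_cbounded.
have ict i j := cintegrableZ (c i j) (it i j).
transitivity (cintegral mu (fun x => \sum_(i < N) \sum_(j < N)
    c i j * (pw i j x * theta x))).
  congr cintegral; apply/funext => x; rewrite /pwsum mulr_suml.
  apply: eq_bigr => i _; rewrite mulr_suml; apply: eq_bigr => j _.
  by rewrite mulrA.
rewrite (cintegral_sum (F := fun i x => \sum_(j < N) c i j * (pw i j x * theta x))).
  apply: eq_bigr => i _.
  rewrite (cintegral_sum (F := fun j x => c i j * (pw i j x * theta x)))//.
  by apply: eq_bigr => j _; rewrite cintegralZ.
move=> i _; apply: (cintegrable_sum (F := fun j x => c i j * (pw i j x * theta x))).
by [].
Qed.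

(** * The Fejer kernel: positivity, mass and Fourier coefficients *)

Definition fejer N : G -> C := pwsum N (fun _ _ => N%:R^-1).

Definition fejer_density N (x : G) : R := Re (fejer N x).

Lemma fejerE N x :
  fejer N x = (N%:R^-1 * normc (\sum_(i < N) chi x ^+ i) ^+ 2)%:C.
Proof.
rewrite rmorphM/= fmorphV rmorph_nat -mul_conjc rmorph_sum /fejer /pwsum/=.
rewrite mulr_suml mulr_sumr; apply: eq_bigr => i _.
rewrite mulr_sumr mulr_sumr; apply: eq_bigr => j _.
by rewrite /pw rmorphXn.
Qed.

Lemma fejer_real N x : fejer N x = (fejer_density N x)%:C.
Proof. by rewrite /fejer_density fejerE. Qed.

Lemma fejer_density_ge0 N x : 0 <= fejer_density N x.
Proof. by rewrite /fejer_density fejerE/= mulr_ge0// ?invr_ge0 ?sqr_ge0. Qed.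

Lemma fejer_density_ker N x : (0 < N)%N -> chi x = 1 -> fejer_density N x = N%:R.
Proof.
move=> N0 c1; rewrite /fejer_density fejerE/= c1.
under eq_bigr do rewrite expr1n.
rewrite sumr_const card_ord normc_nat expr2 mulrA mulVf ?mul1r//.
by rewrite pnatr_eq0 -lt0n.
Qed.

Lemma sum_delta (V : pzRingType) N (a : nat) :
  \sum_(j < N) (a == j :> nat)%:R = (a < N)%:R :> V.
Proof.
elim: N => [|N IH]; first by rewrite big_ord0.
rewrite big_ord_recr/= IH ltnS [in RHS]leq_eqVlt -natrD.
by have [->|aN] := eqVneq a N; rewrite ?ltnn// addn0.
Qed.

(** The number of pairs below [N] with difference [b], that is [N] times the Fejer coefficient of
    chi^b. The truncated subtraction gives the correct value 0 for [b >= N]. *)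
Lemma sum_lt (V : pzRingType) N b : \sum_(j < N) (j + b < N)%:R = (N - b)%:R :> V.
Proof.
rewrite -natr_sum; congr _%:R.
under eq_bigr do rewrite addnC -ltn_subRL.
suff h n c : (\sum_(j < n) (j < c) = minn n c)%N.
  by rewrite h; apply/minn_idPr; exact: leq_subr.
elim: n => [|n IH]; first by rewrite big_ord0 min0n.
rewrite big_ord_recr/= IH; have [nc|cn] := ltnP n c; lia.
Qed.

Lemma fejer_density_bounded N : bounded_measurable (fejer_density N : M -> R).
Proof. by have [] := pwsum_cbounded N (fun _ _ => N%:R^-1). Qed.

(** A bridge between the two settings: states act on real functions, while orthogonality is a
    complex identity. The kernel being real, it weights the two components of [theta] separately. *)
Lemma Rintegral_fejer (theta : M -> C) N : cintegrable mu theta ->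
  Rintegral mu setT (fun x => Re (theta x) * fejer_density N x) +i*
  Rintegral mu setT (fun x => Im (theta x) * fejer_density N x) =
  N%:R^-1 * \sum_(i < N) \sum_(j < N) cintegral mu (fun x => pw i j x * theta x).
Proof.
move=> ith; transitivity (cintegral mu (fun x => fejer N x * theta x)).
  rewrite /cintegral; congr (_ +i* _); apply: eq_Rintegral => x _.
    by rewrite fejer_real cReM/= mul0r subr0 mulrC.
  by rewrite fejer_real cImM/= mul0r addr0 mulrC.
rewrite cintegral_pwsum// mulr_sumr; apply: eq_bigr => i _.
by rewrite mulr_sumr.
Qed.

Lemma ctriv_cintegrable : cintegrable mu (@ctriv R G : M -> C).
Proof.
apply: cbounded_integrable; first exact: haar_finite.
exact/character_cbounded/character1.
Qed.

Lemma Rintegral_fejer_density N : (0 < N)%N -> Rintegral mu setT (fejer_density N) = 1.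
Proof.
move=> N0; have := Rintegral_fejer N ctriv_cintegrable.
under [X in _ = _ * X]eq_bigr => i _.
  under eq_bigr => j _.
    have -> : (fun x => pw i j x * ctriv R (G:=G) x) = pw i j.
      by apply/funext => x; rewrite mulr1.
    rewrite cintegral_pw.
    over.
  rewrite sum_delta ltn_ord.
  over.
rewrite sumr_const card_ord mulVf ?pnatr_eq0 -?lt0n//.
move=> /(congr1 Re)/= <-; apply: eq_Rintegral => x _; exact: esym (mul1r _).
Qed.

(** Only the pairs with [j = i + 1] survive integration, and there are [N] of them below [N.+1]. *)
Lemma Rintegral_fejer_chi N :
  Rintegral mu setT (fun x => Re (chi x) * fejer_density N.+1 x) = N%:R / N.+1%:R.
Proof.
have ichi : cintegrable mu (chi : M -> C).
  by apply: cbounded_integrable; [exact: haar_finite|exact: character_cbounded].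
have := Rintegral_fejer N.+1 ichi.
rewrite (eq_bigr (fun i : 'I_N.+1 => (i + 1 < N.+1)%:R)) => [|i _]; last first.
  rewrite addn1 -sum_delta; apply: eq_bigr => j _; rewrite -cintegral_pw.
  by congr cintegral; apply/funext => x; rewrite /pw exprSr mulrAC.
move=> /(congr1 Re)/= ->.
rewrite sum_lt subn1/=.
have -> : N.+1%:R^-1 * N%:R = (N%:R / N.+1%:R)%:C :> C.
  by rewrite rmorphM/= fmorphV !rmorph_nat mulrC.
by [].
Qed.

Lemma Rintegral_fejer_off (eta : G -> C) N : character eta ->
  (forall i j, pw i j <> eta) ->
  Rintegral mu setT (fun x => Re (conjc (eta x)) * fejer_density N x) = 0 /\
  Rintegral mu setT (fun x => Im (conjc (eta x)) * fejer_density N x) = 0.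
Proof.
move=> ceta off.
have ceta' := characterJ ceta.
have ieta : cintegrable mu ((fun x => conjc (eta x)) : M -> C).
  by apply: cbounded_integrable; [exact: haar_finite|exact: character_cbounded].
have := Rintegral_fejer N ieta.
rewrite big1 ?mulr0 => [[-> ->]//|i _]; rewrite big1// => j _.
apply: cintegral_character => //; first by apply: characterM => //; exact: pw_character.
by move/character_mulJ_triv => h; apply: (off i j); apply: h => //; exact: pw_character.
Qed.

Lemma haar_ker0 : mu [set x : M | chi x = 1] = 0%E.
Proof.
set K : set M := [set x | _].
have mK : measurable K.
  have [_ _ [cR cI]] := cchi.
  have -> : K = ((fun x => Re (chi x)) @^-1` [set 1]) `&`
                ((fun x => Im (chi x)) @^-1` [set 0]).
    apply/seteqP; split=> x; rewrite /K/=; first by move=> ->.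
    by case: (chi x) => a b /= [-> ->].
  have [[mR _] [mI _]] := character_cbounded cchi.
  apply: measurableI.
    by have := mR measurableT _ (measurable_set1 1); rewrite setTI.
  by have := mI measurableT _ (measurable_set1 0); rewrite setTI.
have Kfin : mu K \is a fin_num.
  rewrite ge0_fin_numE//; apply: le_lt_trans (haar_finite haar).
  by apply: le_measure; rewrite ?inE//; exact: subsetT.
have bK := bounded_measurable_indic R mK.
suff : fine (mu K) = 0 by move=> h; rewrite -(fineK Kfin) h.
apply/eqP; rewrite eq_le fine_ge0// andbT; apply/ler_addgt0Pr => e e0.
rewrite add0r; have [n _ /(_ n (leqnn n)) ne] := near_infty_natSinv_lt (PosNum e0).
apply: le_trans (ltW ne); rewrite -[leRHS]mul1r ler_pdivlMr ?ltr0n//.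
have fin := bounded_measurable_integrable (haar_finite haar).
rewrite -[leRHS](@Rintegral_fejer_density n.+1)//.
have -> : fine (mu K) = Rintegral mu setT (\1_K).
  by rewrite /Rintegral integral_indic// setIT.
rewrite -RintegralZr//; last exact: fin.
apply: le_Rintegral => //.
- apply: fin; apply: bounded_measurableM => //; exact: bounded_measurable_cst.
- apply: fin; exact: fejer_density_bounded.
- move=> x _; rewrite -[leRHS]/(fejer_density n.+1 x).
  rewrite ?indicE; have [xK|xK] := boolP (x \in K).
    by rewrite mul1r fejer_density_ker//; rewrite inE in xK.
  by rewrite mul0r fejer_density_ge0.
Qed.

End trigonometric_sums.

(** * The singular measure *)

Section singular_measure.
Local Open Scope complex_scope.
Variables (R : realType) (G : topologicalZmodType).
Local Notation M := (borel G).
Local Notation C := R[i].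
Local Notation Re := (@complex.Re R).
Local Notation Im := (@complex.Im R).
Variables (mu : {measure set M -> \bar R}) (chi : G -> C).
Hypotheses (haar : normalized_haar mu) (cchi : character chi).
Hypothesis chi_free : forall n, (0 < n)%N -> (fun x => chi x ^+ n) <> @ctriv R G.
Hypotheses (hG : hausdorff_space G) (kG : compact [set: G]).

(* lam is in fact the Haar measure of the kernel of chi. *)
Lemma exists_kernel_measure : exists lam : {finite_measure set M -> \bar R},
  [/\ lam setT = 1%E, regular_measure lam,
      Rintegral lam setT (fun x => Re (chi x)) = 1
    & forall eta, character eta -> (forall i j, pw chi i j <> eta) ->
        Rintegral lam setT (fun x => Re (conjc (eta x))) = 0 /\
        Rintegral lam setT (fun x => Im (conjc (eta x))) = 0].
Proof.
(* The order [n.+1] avoids the zero kernel, which is not of mean one and would not define a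
   state. *)
pose I_ n := fun f : M -> R => Rintegral mu setT (fun x => f x * fejer_density chi n.+1 x).
have sI n : state (I_ n).
  apply: state_density.
  - exact: haar_finite.
  - exact: fejer_density_bounded.
  - exact: fejer_density_ge0.
  - exact: Rintegral_fejer_density.
have [lam [lam1 lamreg lamI]] := @weak_limit_measure R (zpt G) I_ hG kG sI.
exists lam; split => //.
- have [_ c1 [cR _]] := cchi; apply: lamI => //.
    by move=> x; rewrite -(c1 x); exact: abs_Re_le.
  have -> : (fun n => I_ n (fun x => Re (chi x))) = (fun n => 1 - n.+1%:R^-1).
    apply/funext => n; rewrite /I_ Rintegral_fejer_chi//.
    by rewrite -[in LHS](addrK 1 n%:R) natr1 mulrBl mulfV ?pnatr_eq0// mul1r.
  rewrite -[X in _ --> X]subr0; apply: cvgB; first exact: cvg_cst.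
  exact: cvg_harmonic.
- move=> eta ceta off; have cJ := characterJ ceta; have [_ c1 [cR cI]] := cJ.
  have z n := Rintegral_fejer_off haar cchi n.+1 ceta off.
  split; apply: lamI => //.
  + by move=> x; rewrite -(c1 x); exact: abs_Re_le.
  + have -> : (fun n => I_ n (fun x => Re (conjc (eta x)))) = (fun=> 0).
      by apply/funext => n; have [] := z n.
    exact: cvg_cst.
  + by move=> x; rewrite -(c1 x); exact: abs_Im_le.
  + have -> : (fun n => I_ n (fun x => Im (conjc (eta x)))) = (fun=> 0).
      by apply/funext => n; have [] := z n.
    exact: cvg_cst.
Qed.

Lemma regular_mzero : regular_measure (@mzero _ M R).
Proof.
move=> A mA; split; apply/eqP; rewrite eq_le; apply/andP; split.
- by apply: le_ereal_inf_tmp => _ [U _ <-].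
- by apply: ereal_inf_lbound; exists setT => //; split=> //; exact: openT.
- apply: ereal_sup_ubound; exists set0 => //; split=> //; exact: compact0.
- by apply: ge_ereal_sup => _ [U _ <-].
Qed.

(** The kernel of [chi] is null for the limit measure by absolute continuity, and so is its
    complement, because the nonnegative function [1 - Re chi] has integral zero. The total mass 1 is
    then contradicted. *)
Lemma not_riesz_of_group (Gamma : set (G -> C)) :
  (forall i j, Gamma (pw chi i j)) -> ~ riesz_set mu Gamma.
Proof.
move=> Gpw riesz.
have [lam [lam1 lamreg lamchi lamoff]] := exists_kernel_measure.
pose z : {finite_measure set M -> \bar R} := @mzero _ M R.
have rz : regular_measure z by exact: regular_mzero.
set K := [set x : M | chi x = 1].
have bchi := character_cbounded cchi.
have lamfin : (lam setT < +oo)%E by rewrite lam1 ltry.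
have mdef : measurable_fun [set: M] (fun x => 1 - Re (chi x)).
  by apply: measurable_funB => //; exact: bchi.1.1.
have chi_le x : Re (chi x) <= 1.
  have [_ c1 _] := cchi; rewrite -(c1 x); exact: le_trans (ler_norm _) (abs_Re_le _).
(* 1 is the only point of the unit circle with real part 1, so the zeros of [1 - Re chi] are exactly
   the kernel. *)
have Re1 x : Re (chi x) = 1 -> chi x = 1.
  move=> r1; have [_ c1 _] := cchi; have := normc_sqr (chi x).
  rewrite c1 r1 -[LHS]addr0 => /addrI/esym/eqP; rewrite sqrf_eq0 => /eqP i0.
  by apply/eqP; rewrite eq_complex r1 i0/= !eqxx.
have mK : measurable K.
  have -> : K = (fun x => 1 - Re (chi x)) @^-1` [set 0].
    apply/seteqP; split=> x; rewrite /K/=; first by move=> ->; rewrite subrr.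
    by move/eqP; rewrite subr_eq0 eq_sym => /eqP; exact: Re1.
  by have := mdef measurableT _ (measurable_set1 0); rewrite setTI.
have lamK : lam K = 0%E.
  (* The positive measure [lam] seen as a complex one: the other three Jordan parts are zero. *)
  have [] := riesz lam z z z lamreg rz rz rz _ K mK (haar_ker0 haar cchi chi_free).
    move=> eta ceta nG; rewrite /cmeasure_fourier /sint.
    have [|-> ->] := lamoff eta ceta; first by move=> i j e; apply: nG; rewrite -e.
    rewrite /Rintegral !integral_measure_zero/= !subrr.
    by rewrite addr0.
  by rewrite /= sube0.
have : (\int[lam]_x `|(1 - Re (chi x))%:E| = 0)%E.
  under eq_integral do rewrite /= ger0_norm ?subr_ge0//.
  have ic := bounded_measurable_integrable lamfin bchi.1.
  have i1 := bounded_measurable_integrable lamfin (bounded_measurable_cst M 1).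
  have i1c : lam.-integrable setT (EFin \o (fun x => 1 - Re (chi x))).
    by have := integrableB measurableT i1 ic.
  rewrite -[LHS]fineK; last exact: integrable_fin_num.
  congr (_%:E); rewrite -[LHS]/(Rintegral lam setT (fun x => 1 - Re (chi x))).
  have s1 : Rintegral lam setT (fun=> 1) = 1 := state_cst 1 (state_Rintegral lam1).
  by rewrite RintegralB// lamchi s1 subrr.
have mdefE : measurable_fun [set: M] (fun x => (1 - Re (chi x))%:E).
  exact/measurable_EFinP.
move/(ae_eq_integral_abs lam measurableT mdefE) => [B [mB lamB KB]].
have : lam setT = 0%E.
  apply/eqP; rewrite eq_le measure_ge0 andbT.
  have sub : [set: M] `<=` K `|` B.
    move=> x _; have [Kx|Kx] := pselect (K x); [by left|right].
    apply: KB => /= /(_ I) [] /eqP; rewrite subr_eq0 eq_sym => /eqP /Re1.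
    exact: Kx.
  apply: (@le_trans _ _ (lam (K `|` B))).
    by apply: le_measure; rewrite ?inE//; exact: measurableU.
  have : (lam (K `|` B) <= lam K + lam B)%E by exact: measureU2.
  by rewrite lamK lamB adde0.
by rewrite lam1 => /eqP; rewrite onee_eq0.
Qed.

End singular_measure.

(** * The unbounded truncation *)

Section unbounded_projection.
Local Open Scope complex_scope.
Variables (R : realType) (G : topologicalZmodType).
Local Notation M := (borel G).
Local Notation C := R[i].
Local Notation Re := (@complex.Re R).
Local Notation Im := (@complex.Im R).
Local Notation normc := (@Normc.normc R).
Variables (mu : {measure set M -> \bar R}) (chi : G -> C).
Hypotheses (haar : normalized_haar mu) (cchi : character chi).
Hypothesis chi_free : forall n, (0 < n)%N -> (fun x => chi x ^+ n) <> @ctriv R G.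

Definition fejer_proj N : G -> C :=
  pwsum chi N (fun i j => if (j <= i)%N then N%:R^-1 else 0).

Lemma L1norm_fejer N : (0 < N)%N -> L1norm mu (fejer chi N) = 1.
Proof.
move=> N0; rewrite -(Rintegral_fejer_density haar cchi chi_free N0) /L1norm.
apply: eq_Rintegral => x _; rewrite fejer_real /= expr0n/= addr0 sqrtr_sqr.
by rewrite ger0_norm// fejer_density_ge0.
Qed.

(** What is removed consists of strictly negative powers of [chi]. These are characters outside
    [Gamma], so every function of [HGamma] has zero Fourier coefficient there, and the conjugates of
    these coefficients are the pairings to be killed. *)
Lemma fejer_is_proj (Gamma : set (G -> C)) N : Gamma `<=` @character R G ->
  (forall n, Gamma (fun x => chi x ^+ n)) ->
  (forall n, (0 < n)%N -> ~ Gamma (fun x => conjc (chi x) ^+ n)) ->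
  is_proj mu Gamma (fejer chi N) (fejer_proj N).
Proof.
move=> Gchar Gpos Gneg; have hfin := haar_finite haar.
split.
  split; first by apply: cbounded_L2 => //; exact: pwsum_cbounded.
  move=> eta ceta nG; rewrite /fourier.
  have cJ := characterJ ceta.
  rewrite cintegral_pwsum//; last first.
    by apply: cbounded_integrable => //; exact: character_cbounded.
  rewrite big1// => i _; rewrite big1// => j _; case: leqP => ji; last by rewrite mul0r.
  rewrite cintegral_character ?mulr0//.
    by apply: characterM => //; exact: pw_character.
  move/character_mulJ_triv => h; apply: nG; rewrite -h//; last exact: pw_character.
  by rewrite pw_ge//; exact: Gpos.
move=> h [L2h Fh]; have ih := L2_cintegrable hfin L2h.
have ihJ : cintegrable mu (fun x => conjc (h x)).
  case: ih => iR iI; split.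
    by move: iR; congr (mu.-integrable _ _); apply/funext => x /=; rewrite cReJ.
  have := integrable_scale (-1) iI.
  by congr (mu.-integrable _ _); apply/funext => x /=; rewrite cImJ mulN1r.
have -> : (fun x => (fejer chi N x - fejer_proj N x) * conjc (h x)) =
    (fun x => pwsum chi N (fun i j => if (j <= i)%N then 0 else N%:R^-1) x * conjc (h x)).
  apply/funext => x; congr (_ * _); rewrite /fejer /fejer_proj /pwsum -sumrB.
  apply: eq_bigr => i _; rewrite -sumrB; apply: eq_bigr => j _.
  by rewrite -mulrBl; case: ifP; rewrite ?subrr ?subr0.
rewrite cintegral_pwsum// big1// => i _; rewrite big1// => j _.
case: leqP => ij; first by rewrite mul0r.
have cpw : character (pw chi i j) by exact: pw_character.
have : fourier mu h (pw chi i j) = 0.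
  apply: Fh => //; rewrite pw_le ?(ltnW ij)//; apply: Gneg.
  by rewrite subn_gt0.
rewrite /fourier => F0.
have -> : (fun x => pw chi i j x * conjc (h x)) =
    (fun x => conjc (h x * conjc (pw chi i j x))).
  by apply/funext => x; rewrite rmorphM/= conjcK mulrC.
rewrite cintegral_conj ?F0 ?conjc0 ?mulr0//.
have := cintegrableM (cbounded_conj (character_cbounded cpw)) ih.
by congr cintegrable; apply/funext => x; rewrite mulrC.
Qed.

(* sum_(1 <= k <= N) (chi^-k - chi^k) / k: a bounded function whose Fourier
   coefficients detect the harmonic series. *)
Definition sawtooth N (x : G) : C :=
  \sum_(k < N) k.+1%:R^-1 * (conjc (chi x) ^+ k.+1 - chi x ^+ k.+1).

Lemma sawtooth_bound N x : normc (sawtooth N x) <= 6.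
Proof. by have [_ c1 _] := cchi; exact: sine_sum_bound. Qed.

Lemma sawtooth_term_cbounded k :
  cbounded (fun x : M => k.+1%:R^-1 * (conjc (chi x) ^+ k.+1 - chi x ^+ k.+1)).
Proof.
have bc := character_cbounded cchi.
apply: cboundedM; first exact: cbounded_cst.
apply: cboundedD; first by apply: cboundedX; exact: cbounded_conj.
have := cboundedM (cbounded_cst G (-1 : C)) (cboundedX k.+1 bc).
by congr cbounded; apply/funext => x; rewrite mulN1r.
Qed.

Lemma sawtooth_cbounded N : cbounded (sawtooth N : M -> C).
Proof.
exact: (@cbounded_sum R G N
  (fun k x => k.+1%:R^-1 * (conjc (chi x) ^+ k.+1 - chi x ^+ k.+1))
  sawtooth_term_cbounded).
Qed.

(** For [j <= i] the positive half of the sawtooth only raises the nonnegative exponent i - j, so it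
    integrates to zero; the negative half meets it at [k.+1 = i - j]. On the untruncated kernel the
    two halves would cancel. *)
Lemma cintegral_pw_sawtooth N (i j : nat) : (j <= i)%N ->
  cintegral mu (fun x => pw chi i j x * sawtooth N x) =
  \sum_(k < N) k.+1%:R^-1 * (i == j + k.+1)%N%:R.
Proof.
move=> ji; have hfin := haar_finite haar.
have ipw a b : cintegrable mu (pw chi a b).
  by apply: cbounded_integrable => //; exact: pw_cbounded.
pose F k x := k.+1%:R^-1 * (pw chi i (j + k.+1) x + -1 * pw chi (i + k.+1) j x).
transitivity (cintegral mu (fun x => \sum_(k < N) F k x)).
  congr cintegral; apply/funext => x; rewrite /sawtooth mulr_sumr.
  apply: eq_bigr => k _; rewrite /F mulN1r mulrCA mulrBr; congr (_ * (_ - _)).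
    by rewrite /pw exprD mulrA.
  by rewrite /pw exprD mulrAC.
have iin k : cintegrable mu (fun x => pw chi i (j + k.+1) x + -1 * pw chi (i + k.+1) j x).
  have := cintegrable_lin (-1) (ipw (i + k.+1)%N j) (ipw i (j + k.+1)%N).
  by congr cintegrable; apply/funext => x; rewrite addrC.
rewrite cintegral_sum => [|k _]; last exact: cintegrableZ.
apply: eq_bigr => k _; rewrite cintegralZ//; congr (_ * _).
have -> : (fun x => pw chi i (j + k.+1) x + -1 * pw chi (i + k.+1) j x) =
   (fun x => -1 * pw chi (i + k.+1) j x + pw chi i (j + k.+1) x).
  by apply/funext => x; rewrite addrC.
rewrite cintegral_lin// !cintegral_pw//.
have -> : (i + k.+1 == j)%N = false by apply/negbTE; rewrite neq_ltn; lia.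
by rewrite mulr0 add0r.
Qed.

Lemma cintegral_fejer_sawtooth N : (0 < N)%N ->
  cintegral mu (fun x => fejer_proj N x * sawtooth N x) =
  (\sum_(k < N) k.+1%:R^-1 - 1)%:C.
Proof.
move=> N0; have hfin := haar_finite haar.
have N0C : N%:R != 0 :> C by rewrite pnatr_eq0 -lt0n.
rewrite cintegral_pwsum//; last first.
  by apply: cbounded_integrable => //; exact: sawtooth_cbounded.
transitivity (\sum_(i < N) \sum_(j < N) \sum_(k < N)
   N%:R^-1 * (k.+1%:R^-1 * (i == j + k.+1 :> nat)%N%:R) : C).
  apply: eq_bigr => i _; apply: eq_bigr => j _; case: leqP => ji.
    by rewrite cintegral_pw_sawtooth// mulr_sumr.
  rewrite mul0r big1// => k _.
  have -> : (i == j + k.+1 :> nat)%N = false by apply/negbTE; rewrite neq_ltn; lia.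
  by rewrite !mulr0.
under eq_bigr do rewrite exchange_big/=.
rewrite exchange_big/= rmorphB rmorph1 rmorph_sum/=.
(* With 1 spread over the [N] terms the identity holds term by term: [N - k.+1] pairs, each of
   weight [1 / (N * k.+1)], give [1 / k.+1 - 1 / N]. *)
rewrite [X in _ = _ - X](_ : 1 = \sum_(k < N) N%:R^-1); last first.
  by rewrite sumr_const card_ord -[RHS]mulr_natl mulfV.
rewrite -sumrB; apply: eq_bigr => k _.
have -> : \sum_(i < N) \sum_(j < N) N%:R^-1 * (k.+1%:R^-1 * (i == j + k.+1 :> nat)%N%:R)
    = N%:R^-1 * (k.+1%:R^-1 * (N - k.+1)%:R) :> C.
  rewrite exchange_big/= -sum_lt !mulr_sumr; apply: eq_bigr => j _.
  rewrite -!mulr_sumr -sum_delta; congr (_ * (_ * _)).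
  by apply: eq_bigr => i _; rewrite eq_sym.
have k0 : k.+1%:R != 0 :> C by rewrite pnatr_eq0.
rewrite natrB ?ltn_ord// fmorphV rmorph_nat.
by move: (k.+1%:R : C) k0 => a a0; field; rewrite N0C a0.
Qed.

Lemma harmonic_unbounded (K : R) : exists N, (0 < N)%N /\ K < \sum_(k < N) k.+1%:R^-1.
Proof.
apply: contrapT => /forallNP h; apply: (@dvg_harmonic R).
apply: nondecreasing_is_cvgn.
  apply/nondecreasing_seqP => n; rewrite /series/= big_nat_recr//= lerDl.
  by rewrite invr_ge0.
(* The 0 bounds the empty sum, on which [h] gives no information. *)
exists (Num.max K 0) => _ [N _ <-]; rewrite /series/= big_mkord.
have [->|N0] := posnP N; first by rewrite big_ord0 le_max lexx orbT.
have /not_andP[//|/negP] := h N; rewrite -leNgt => SK.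
by rewrite le_max SK.
Qed.

Lemma not_proj_extends (Gamma : set (G -> C)) : Gamma `<=` @character R G ->
  (forall n, Gamma (fun x => chi x ^+ n)) ->
  (forall n, (0 < n)%N -> ~ Gamma (fun x => conjc (chi x) ^+ n)) ->
  ~ proj_extends_L1 mu Gamma.
Proof.
move=> Gchar Gpos Gneg [T [K [Tbound _ Tproj]]].
have hfin := haar_finite haar.
(* 6 is the uniform bound of the sawtooth and 1 the loss in its pairing with the truncated kernel:
   boundedness by [K] would give H_N - 1 <= 6 K. *)
have [N [N0 KN]] := harmonic_unbounded (6 * K + 1).
have bf : cbounded (fejer chi N : M -> C) by exact: pwsum_cbounded.
have bg : cbounded (fejer_proj N : M -> C) by exact: pwsum_cbounded.
have [L1T] := Tbound _ (cbounded_L1 hfin bf).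
rewrite L1norm_fejer// mulr1 => TK.
have Tg := Tproj _ _ (cbounded_L2 hfin bf) (fejer_is_proj N Gchar Gpos Gneg).
have gK : L1norm mu (fejer_proj N) <= K.
  rewrite -(L1norm_ae_eq _ _ Tg)//; first by case: L1T.
  by have [] := cbounded_L1 hfin bg.
have := Re_cintegral_le hfin bg (sawtooth_cbounded N) (sawtooth_bound N).
rewrite cintegral_fejer_sawtooth//= => h.
have : \sum_(k < N) k.+1%:R^-1 - 1 <= 6 * K.
  by apply: le_trans h _; rewrite ler_wpM2l.
by rewrite lerBlDr leNgt KN.
Qed.

End unbounded_projection.

(** * The dichotomy on negative powers in [Gamma] *)

Theorem theorem3p9 (R : realType) (G : topologicalZmodType)
    (mu : {measure set (borel G) -> \bar R}) (Gamma : set (G -> R[i])) :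
  hausdorff_space G -> compact [set: G] -> connected [set: G] ->
  normalized_haar mu ->
  submonoid Gamma ->
  Gamma <> [set @ctriv R G] ->
  riesz_set mu Gamma ->
  ~ proj_extends_L1 mu Gamma.
Proof.
move=> hG kG conG haar [Gchar G1 GM] Gne riesz.
have [xi [Gxi xi1]] : exists xi, Gamma xi /\ xi <> @ctriv R G.
  apply: contrapT => /forallNP h; apply: Gne; apply/seteqP; split=> [xi Gxi|_ ->//].
  by have /not_andP[//|/contrapT] := h xi.
have cxi := Gchar _ Gxi.
have GX chi n : Gamma chi -> Gamma (fun x => chi x ^+ n).
  move=> Gchi; elim: n => [|n IH]; first by under eq_fun do rewrite expr0.
  by under eq_fun do rewrite exprS; exact: GM.
have xi_free n : (0 < n)%N -> (fun x => xi x ^+ n) <> @ctriv R G.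
  by move=> n0 /(character_torsion_free conG cxi n0).
have [[n [n0 Gn]]|Gneg] := pselect (exists n, (0 < n)%N /\ Gamma (fun x => conjc (xi x) ^+ n)).
  pose chi x := xi x ^+ n.
  have cchi : character chi by exact: characterX.
  have chi_free k : (0 < k)%N -> (fun x => chi x ^+ k) <> @ctriv R G.
    move=> k0 h; apply: (xi_free (n * k)%N); first by rewrite muln_gt0 n0.
    by rewrite -h; apply/funext => x; rewrite exprM.
  exfalso; apply: (not_riesz_of_group haar cchi chi_free hG kG _ riesz) => i j.
  apply: GM; first exact/GX/GX.
  have -> : (fun x => conjc (chi x) ^+ j) = (fun x => (conjc (xi x) ^+ n) ^+ j).
    by apply/funext => x; rewrite /chi rmorphXn.
  exact: GX Gn.
apply: (not_proj_extends haar cxi xi_free Gchar) => n; first exact: GX.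
by move=> n0 Gn; apply: Gneg; exists n.
Qed.
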